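(* Let $H=H_n$, and let $\Phi:\mathbb{R}\to\mathrm{Aut}(H)$ be a lattice-compatible path that is metric-defining with respect to a splitting $\mathfrak{h}=\mathfrak{p}\oplus\mathbb{R}Z_0$ with $0\neq Z_0\in\mathfrak{z}$. Let $L$ be a lattice of $H$ preserved by $\Phi_q$ for all $q\in\mathbb{Z}$, and let $\Gamma=\mathbb{Z}\ltimes_\Phi L$ act on $\mathbb{R}*_\Phi H$ by $$(t,g).(q,\lambda)=(t+q,\Phi_q(g)\cdot\lambda).$$ Then the $\Gamma$-action is isometric for the Lorentz metric on $\mathbb{R}*_\Phi H$ associated to $\Phi$ and $Z_0$, so the metric descends to the compact quotient $M=(\mathbb{R}*_\Phi H)/\Gamma$.
   Context: $H=H_n$ ($n\ge 1$) is the simply connected Lie group with Lie algebra $\mathfrak{h}$ having basis $X_1,\dots,X_n,Y_1,\dots,Y_n,Z$ with only nonzero brackets $[X_i,Y_i]=Z=-[Y_i,X_i]$; $\mathfrak{z}=\mathbb{R}Z$ is its center. Elements of $\mathfrak{h}$ are regarded as right-invariant vector fields on $H$, with the corresponding bracket, so that for a left action of $H$ the map $X\mapsto X^*$ to the induced vector fields is a Lie algebra homomorphism; $e^{tX}$ is the one-parameter subgroup with velocity $X$ at the identity. Let $\omega_0$ be the symplectic form on $\mathfrak{p}$ with $[X,Y]=\omega_0(X,Y)Z_0$. An endomorphism $\nu$ of $\mathfrak{p}$ is infinitesimally definite if $\omega_0(X,\nu(X))>0$ for all $0\neq X\in\mathfrak{p}$. Let $\mathcal{M}_{\mathfrak{p}}$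 be the set of derivations $\delta$ of $\mathfrak{h}$ preserving $\mathfrak{p}$ with $\delta(Z_0)=0$ and $\delta|_{\mathfrak{p}}$ infinitesimally definite. A (smooth) path $\Phi:\mathbb{R}\to\mathrm{Aut}(H)$, with $\varphi_t=D_e\Phi_t$, is metric-defining with respect to $\mathfrak{p}$ and $Z_0$ if $\varphi_t^{-1}\circ\left(\frac{\partial\varphi_s}{\partial s}\right)_{s=t}\in\mathcal{M}_{\mathfrak{p}}$ for all $t$; $\nu_t$ denotes the restriction of this derivation to $\mathfrak{p}$ (it is invertible). $\mathbb{R}*_\Phi H$ is the manifold $\mathbb{R}\times H$ with $H$-action $h.(t,g)=(t,\Phi_t(h)g)$. Let $W=\partial/\partial t$ and $f_x(Y)=\frac{d}{dr}\big|_{r=0}(e^{rY}.x)$ for $Y\in\mathfrak{h}$. The associated Lorentz metric is defined at each $x$, with $\mathbb{R}$-coordinate $t(x)$, by: $\langle W,W\rangle=0$, $\langle W,f_x(Z_0)\rangle=1$, $W\perp f_x(\mathfrak{p})$, $\langle f_x(Z_0),f_x(Z_0)\rangle=0$, $f_x(Z_0)\perp f_x(\mathfrak{p})$, and $\langle f_x(X),f_x(Y)\rangle=\omega_0(\nu_{t(x)}^{-1}(X),Y)$ for $X,Y\in\mathfrak{p}$. $\Phi$ is $\mathbb{Z}$-equivariant if $\Phi_{q+t}=\Phi_q\Phi_t$ for all $t\in\mathbb{R}$, $q\in\mathbb{Z}$; it is lattice-compatible if it is $\mathbb{Z}$-equivariant and some lattice $L$ of $H$ is preserved by $\Phi_q$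 for all $q\in\mathbb{Z}$. The group law of $\Gamma=\mathbb{Z}\ltimes_\Phi L$ making the displayed formula a right action is $(q,\lambda)(q',\lambda')=(q+q',\Phi_{q'}(\lambda)\lambda')$. *)

(* Defs.v *)
From HB Require Import structures.
From mathcomp Require Import all_boot all_order all_algebra.
From mathcomp Require Import all_classical all_reals all_analysis.

Set Implicit Arguments.
Unset Strict Implicit.
Unset Printing Implicit Defensive.

Import Order.TTheory GRing.Theory Num.Theory.
Import numFieldNormedType.Exports.

Local Open Scope classical_set_scope.
Local Open Scope ring_scope.
Local Open Scope quotient_scope.

Section Smoothness.
Context {R : realType}.

(* C^k on an open set of a finite-dimensional space: all iterated directional
   derivatives up to order k exist (as Fréchet differentials) and are
   continuous. *)
Fixpoint Ck_on {V W : normedModType R} (k : nat) (U : set V) (f : V -> W)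
    : Prop :=
  if k is k'.+1 then
    (forall x, U x -> differentiable f x) /\
    (forall v, Ck_on k' U (fun x => 'd f x v))
  else forall x, U x -> {for x, continuous f}.

Definition smooth_on {V W : normedModType R} (U : set V) (f : V -> W) : Prop :=
  forall k, Ck_on k U f.

Definition diffeo_on {V W : normedModType R} (U : set V) (U' : set W)
    (f : V -> W) : Prop :=
  [/\ open U, open U', smooth_on U f &
      exists g : W -> V,
        [/\ smooth_on U' g,
            forall x, U x -> U' (f x) /\ g (f x) = x &
            forall y, U' y -> U (g y) /\ f (g y) = y]].

End Smoothness.

Section Manifolds.
Context {R : realType} {E : normedModType R} {M : topologicalType}.

Record chart := Chart {
  chart_dom : set M;
  chart_cod : set E;
  chart_fun : M -> E;
  chart_inv : E -> M }.

(* A homeomorphism from an open set of M to an open set of E; the values of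
   the two total functions outside these sets are irrelevant. *)
Definition is_chart (c : chart) : Prop :=
  [/\ open (chart_dom c) /\ open (chart_cod c),
      forall p, chart_dom c p ->
        chart_cod c (chart_fun c p) /\ chart_inv c (chart_fun c p) = p,
      forall y, chart_cod c y ->
        chart_dom c (chart_inv c y) /\ chart_fun c (chart_inv c y) = y,
      forall p, chart_dom c p -> {for p, continuous (chart_fun c)} &
      forall y, chart_cod c y -> {for y, continuous (chart_inv c)}].

Definition transition (c d : chart) : E -> E := chart_fun d \o chart_inv c.

Definition overlap (c d : chart) : set E :=
  chart_cod c `&` chart_inv c @^-1` chart_dom d.

Definition smooth_atlas (A : set chart) : Prop :=
  [/\ forall c, A c -> is_chart c,
      forall p, exists2 c, A c & chart_dom c p &
      forall c d, A c -> A d -> smooth_on (overlap c d) (transition c d)].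

Definition smooth_manifold (A : set chart) : Prop :=
  [/\ hausdorff_space M, @second_countable M & smooth_atlas A].

Definition local_diffeo {V : normedModType R} (A : set chart) (f : V -> M)
    : Prop :=
  forall x, exists c (U : set V) (U' : set E),
    [/\ A c, U x, forall z, U z -> chart_dom c (f z) &
        diffeo_on U U' (chart_fun c \o f)].

End Manifolds.
Arguments chart {R} E M.

Section LorentzMetrics.
Context {R : realType}.

(* Signature (1, dim V - 1), i.e. (-, +, ..., +). *)
Definition lorentz_form {V : lmodType R} (b : V -> V -> R) : Prop :=
  [/\ forall a u v w, b (a *: u + v) w = a * b u w + b v w,
      forall u v, b u v = b v u &
      exists2 u, b u u < 0 & forall v, b u v = 0 -> v != 0 -> 0 < b v v].

Definition lorentz_metric_on {V : normedModType R} (U : set V)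
    (g : V -> V -> V -> R) : Prop :=
  (forall x, U x -> lorentz_form (g x)) /\
  (forall u v, smooth_on U (fun x => g x u v)).

Definition is_isometry {V : normedModType R} (g : V -> V -> V -> R) (f : V -> V)
    : Prop :=
  diffeo_on setT setT f /\
  forall x u v, g (f x) ('d f x u) ('d f x v) = g x u v.

(* A Lorentz metric on a manifold is given by its expressions h c in the
   charts c of the atlas, which have to agree under changes of charts. *)
Definition lorentz_metric {E : normedModType R} {M : topologicalType}
    (A : set (chart E M)) (h : chart E M -> E -> E -> E -> R) : Prop :=
  (forall c, A c -> lorentz_metric_on (chart_cod c) (h c)) /\
  (forall c d, A c -> A d -> forall y, overlap c d y -> forall u v,
     h c y u v =
     h d (transition c d y) ('d (transition c d) y u) ('d (transition c d) y v)).

Definition is_pullback {V E : normedModType R} {M : topologicalType}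
    (A : set (chart E M)) (f : V -> M) (h : chart E M -> E -> E -> E -> R)
    (g : V -> V -> V -> R) : Prop :=
  forall c, A c -> forall x, chart_dom c (f x) -> forall u v,
    g x u v = h c (chart_fun c (f x)) ('d (chart_fun c \o f) x u)
                                      ('d (chart_fun c \o f) x v).

End LorentzMetrics.

Section OrbitSpaces.
Context {R : realType} {T : normedModType R} (orb : T -> set T).

Definition same_orbit (x y : T) : bool := `[< orb x = orb y >].

Lemma same_orbit_refl : reflexive same_orbit.
Proof. by move=> x; apply/asboolP. Qed.

Lemma same_orbit_sym : symmetric same_orbit.
Proof. by move=> x y; apply/asboolP/asboolP. Qed.

Lemma same_orbit_trans : transitive same_orbit.
Proof. by move=> y x z /asboolP xy /asboolP yz; apply/asboolP; rewrite xy. Qed.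

Definition orbit_rel : equiv_rel T :=
  EquivRel same_orbit same_orbit_refl same_orbit_sym same_orbit_trans.

(* The measurable structures of the library require a pointed carrier. *)
Definition orbit_space : ptopologicalType :=
  quotient_topology {eq_quot orbit_rel}.

Definition orbit_proj (x : T) : orbit_space :=
  \pi_(quotient_topology {eq_quot orbit_rel}) x.

End OrbitSpaces.

(* The Heisenberg algebra; ((x, y), z) is \sum_i (x_i X_i + y_i Y_i) + z Z.
   The same type, via the exponential map, carries the Heisenberg group. *)
Notation heis R n := ('rV[R]_n * 'rV[R]_n * R)%type.

Section Heisenberg.
Context {R : realType} {n : nat}.
Local Notation h := (heis R n).

Definition bracket (U V : h) : h :=
  ((0, 0), \sum_(i < n) (U.1.1 0 i * V.1.2 0 i - U.1.2 0 i * V.1.1 0 i)).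

Definition Zbase : h := ((0, 0), 1).

(* For n > 0 these are exactly the V such that bracket V W = 0 for all W. *)
Definition hcenter : set h := [set V | exists c, V = c *: Zbase].

(* Group law of H in exponential coordinates.  The sign is the one for which
   [bracket] is the bracket of the right-invariant vector fields
   g |-> d/dr|_{r=0} (r *: X) * g = X - 2^-1 *: bracket X g.
   The unit is 0, the inverse of g is - g, and r |-> r *: X is the
   one-parameter subgroup e^{rX}. *)
Definition hmul (g k : h) : h := g + k - 2^-1 *: bracket g k.

Definition splitting (p : set h) (Z0 : h) : Prop :=
  [/\ p 0,
      forall (a : R) U V, p U -> p V -> p (a *: U + V),
      forall V, exists c : R, p (V - c *: Z0) &
      forall c : R, p (c *: Z0) -> c *: Z0 = 0].

Definition omega0 (Z0 : h) (U V : h) : R := (bracket U V).2 / Z0.2.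

Lemma bracket_omega0 (Z0 U V : h) : hcenter Z0 -> Z0 != 0 ->
  bracket U V = omega0 Z0 U V *: Z0.
Proof.
case=> c -> nz; have c0 : c != 0 by apply: contraNneq nz => ->; rewrite scale0r.
rewrite /omega0 /bracket /Zbase scalerA; congr (_, _) => /=.
  by congr (_, _); rewrite /= scaler0.
by rewrite /GRing.scale /= !mulr1 divfK.
Qed.

Definition inf_definite (Z0 : h) (p : set h) (nu : h -> h) : Prop :=
  forall U, p U -> U != 0 -> 0 < omega0 Z0 U (nu U).

Definition derivation (d : h -> h) : Prop :=
  (forall (a : R) U V, d (a *: U + V) = a *: d U + d V) /\
  (forall U V, d (bracket U V) = bracket (d U) V + bracket U (d V)).

Definition Mp (p : set h) (Z0 : h) : set (h -> h) :=
  [set d | [/\ derivation d, forall U, p U -> p (d U), d Z0 = 0 &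
               inf_definite Z0 p d]].

Definition lie_aut (f : h -> h) : Prop :=
  {morph f : g k / hmul g k} /\ diffeo_on setT setT f.

Implicit Type Phi : R -> h -> h.

(* Smooth paths in Aut(H): smoothness means joint smoothness in (t, g). *)
Definition aut_path Phi : Prop :=
  (forall t, lie_aut (Phi t)) /\
  smooth_on setT (fun x : R * h => Phi x.1 x.2).

Definition dPhi Phi (t : R) : h -> h := 'd (Phi t) (0 : h).

Definition dPhi_inv Phi (t : R) : h -> h := 'pinv_(fun=> 0) setT (dPhi Phi t).

Definition log_deriv Phi (t : R) (X : h) : h :=
  dPhi_inv Phi t (derive1 (fun s : R => dPhi Phi s X) t).

Definition metric_defining Phi (p : set h) (Z0 : h) : Prop :=
  forall t, Mp p Z0 (log_deriv Phi t).

(* The inverse of the restriction of log_deriv Phi t to p. *)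
Definition nu_inv Phi (p : set h) (t : R) : h -> h :=
  'pinv_(fun=> 0) p (log_deriv Phi t).

Definition hact Phi (k : h) (x : R * h) : R * h := (x.1, hmul (Phi x.1 k) x.2).

(* Tangent spaces of R x H are identified with R * h by the global chart. *)
Definition fund Phi (x : R * h) (Y : h) : R * h :=
  derive1 (fun r : R => hact Phi (r *: Y) x) 0.

Definition Wfield : R * h := (1, 0).

Definition associated_metric Phi (p : set h) (Z0 : h)
    (g : R * h -> R * h -> R * h -> R) : Prop :=
  forall x, let f := fund Phi x in
  [/\ forall a u v w, g x (a *: u + v) w = a * g x u w + g x v w,
      forall u v, g x u v = g x v u,
      [/\ g x Wfield Wfield = 0, g x Wfield (f Z0) = 1 &
          forall X, p X -> g x Wfield (f X) = 0],
      g x (f Z0) (f Z0) = 0 /\ (forall X, p X -> g x (f Z0) (f X) = 0) &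
      forall X Y, p X -> p Y ->
        g x (f X) (f Y) = omega0 Z0 (nu_inv Phi p x.1 X) Y].

Definition subgroup (L : set h) : Prop :=
  [/\ L 0, forall g k, L g -> L k -> L (hmul g k) & forall g, L g -> L (- g)].

Definition discrete_subset (L : set h) : Prop :=
  forall g, L g -> exists2 U, nbhs g U & U `&` L = [set g].

Definition left_coset (L : set h) (g : h) : set h :=
  [set hmul g l | l in L].

Local Notation borel T := (g_sigma_algebraType (@open T)).

(* A discrete subgroup L such that H / L carries a nonzero finite Borel measure
   that is invariant under the left translations by H. *)
Definition lattice (L : set h) : Prop :=
  [/\ subgroup L, discrete_subset L &
      exists mu : {measure set (borel (orbit_space (left_coset L))) -> \bar R},
        [/\ (0 < mu setT)%E, (mu setT < +oo)%E &
            forall (k : h) (A : set (borel (orbit_space (left_coset L)))),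
              measurable A ->
              mu [set orbit_proj (left_coset L) (hmul k g) |
                    g in orbit_proj (left_coset L) @^-1` A] = mu A]].

Definition Z_equivariant Phi : Prop :=
  forall (q : int) (t : R) g, Phi (q%:~R + t) g = Phi q%:~R (Phi t g).

Definition preserved Phi (L : set h) : Prop :=
  forall q : int, Phi q%:~R @` L = L.

Definition lattice_compatible Phi : Prop :=
  Z_equivariant Phi /\ exists L, lattice L /\ preserved Phi L.

(* Gamma = Z |x_Phi L, as a subset of int * h with the law [gamma_mul]. *)
Definition gamma (L : set h) : set (int * h) := [set c | L c.2].

Definition gamma_mul Phi (c d : int * h) : int * h :=
  (c.1 + d.1, hmul (Phi d.1%:~R c.2) d.2).

Definition gamma_act Phi (x : R * h) (c : int * h) : R * h :=
  (x.1 + c.1%:~R, hmul (Phi c.1%:~R x.2) c.2).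

Definition gamma_right_action Phi (L : set h) : Prop :=
  (forall x, gamma_act Phi x (0, 0) = x) /\
  (forall x c d, gamma L c -> gamma L d ->
     gamma L (gamma_mul Phi c d) /\
     gamma_act Phi (gamma_act Phi x c) d = gamma_act Phi x (gamma_mul Phi c d)).

Definition gamma_orbit Phi (L : set h) (x : R * h) : set (R * h) :=
  [set gamma_act Phi x c | c in gamma L].

End Heisenberg.

(* Main.v *)
Require Import Defs.
From HB Require Import structures.
From mathcomp Require Import all_boot all_order all_algebra.
From mathcomp Require Import all_classical all_reals all_analysis.
From mathcomp Require Import ring lra zify.
Import Order.TTheory GRing.Theory Num.Theory.
Import numFieldNormedType.Exports.
Local Open Scope classical_set_scope.
Local Open Scope ring_scope.

Set Implicit Arguments.
Unset Strict Implicit.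
Unset Printing Implicit Defensive.

(** The proof rests on three observations.

    Automorphisms are linear.  In exponential coordinates an automorphism [f]
    of [H] commutes with the scalings by [1/m] ([f (U / m)] is the [m]-th root
    of [f U] on a one-parameter subgroup), so it equals its own differential at
    the unit ([lie_aut_diff]).  Hence [dPhi Phi t = Phi t], and every map of
    the problem is affine or given by a smooth family of linear maps and of
    their inverses.  The fundamental fields are explicit:
    [f_x(Y) = (0, Phi_t(Y) - 1/2 [Phi_t(Y), g])] at [x = (t, g)], and [W], [f_x(Z0)],
    [f_x(p)] span the tangent space, so the defining relations determine the
    metric ([associated_metric_unique]) and, read as a formula, define one
    ([canonical_metric_associated]).  Symmetry holds because a derivation
    killing [Z0] is skew for [omega0]; the signature is Lorentzian because
    [omega0 (nu^-1 X, X)] is positive while [W] and [f_x(Z0)] span a hyperbolic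
    plane.  Smoothness reduces, by coordinates, to Cramer's rule
    ([Ck_on_inverse_family]).

    Isometry is naturality.  From [Phi_{q+t} = Phi_q Phi_t], the map
    [x |-> x.(q, lambda)] carries [W] to [W] and [f_x(Y)] to [f_{x.c}(Y)], and
    [nu_{t+q} = nu_t].  So the pulled back metric satisfies the relations that
    characterize the metric, and equals it ([gamma_act_isometry]).

    The quotient.  [Gamma] acts freely and properly: if points near [x] and [y]
    are related by [(q, l)] then [q] is the integer near the difference of the
    [R]-coordinates and [l] is the element of the discrete set [L] near
    [Phi_q(g)^-1 g'] ([gamma_act_proper]).  Local sections of the projection then
    form an atlas ([slice_atlas_manifold]), and for any atlas that makes the
    projection a local diffeomorphism the metric is transported through local
    inverses, the choice of preimage being immaterial by isometry
    ([descended_lorentz]).  Compactness is that of [H / L]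
    ([lattice_cocompact]).  A continuous character of [H] that is trivial on [L]
    pushes the invariant measure on [H / L] forward to a finite nonzero
    translation invariant measure on [R], which is absurd unless the character
    is trivial ([lattice_character]).  So the image of [L] spans [H / Z]; hence
    [L] contains two elements that do not commute and, with their commutator,
    a nonzero central element; rounding coordinates brings every [g] into a
    fixed box by an element of [L]. *)

(** * Calculus of C^k maps *)

Section SmoothMaps.
Context {R : realType}.
Implicit Types V W Z : normedModType R.

(** The differential is a total function defined by choice, so that its dependence
    on the germ of the map alone has to be proved. *)
Lemma diff_near_eq V W (f h : V -> W) (x : V) :
  (\forall y \near x, f y = h y) -> differentiable f x ->
  differentiable h x /\ 'd h x = 'd f x :> (V -> W).
Proof.
move=> fh /diff_locallyP [cdf /eqaddoP E].
have fhx : f x = h x by exact: nbhs_singleton fh.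
have E' : h \o shift x = cst (h x) + 'd f x +o_ 0 id.
  apply/eqaddoP => e e0; have := E e e0.
  have : \forall y \near (0 : V), f (y + x) = h (y + x).
    have := fh; rewrite [X in X -> _](near_shift 0) /=.
    by apply: filterS => y; rewrite subr0.
  apply: filterS2 => y fhy.
  by rewrite -![(_ + _ : _ -> _) _]/(_ + _) -![(- _ : _ -> _) _]/(- _) /= fhy -fhx.
have dh : 'd h x = 'd f x :> (V -> W) by apply: diff_unique.
split; last exact: dh.
by apply/diff_locallyP; rewrite dh; split; [exact: cdf|exact: E'].
Qed.

Lemma diff_compE V W Z (f : V -> W) (g : W -> Z) (x v : V) :
  differentiable f x -> differentiable g (f x) ->
  'd (fun y => g (f y)) x v = 'd g (f x) ('d f x v).
Proof. by move=> df dg; rewrite (diff_comp df dg). Qed.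

Lemma diff_linE V W (l : {linear V -> W}) (x v : V) :
  continuous l -> 'd l x v = l v.
Proof.
move=> cl; have dl : ('d l x : V -> W) = l := diff_lin x cl.
by rewrite dl.
Qed.

(** [Ck_on] is defined by recursion on total functions, and its successor case
    replaces [f] by its differential, which is only known on the open set under
    consideration; this lemma is what allows [f] to be replaced by any map that
    agrees with it locally. *)
Lemma Ck_on_local V W k (U : set V) (f : V -> W) :
  (forall x, U x -> exists (N : set V) (h : V -> W),
    [/\ open N, N x, forall y, N y -> h y = f y & Ck_on k N h]) ->
  Ck_on k U f.
Proof.
elim: k U f => [|k IH] U f H /=.
  move=> x /H[N [h [oN Nx hf Nh]]].
  have nN : \forall y \near x, h y = f y.
    by apply: filterS hf _; exact: open_nbhs_nbhs.
  have := Nh x Nx; rewrite /prop_for /continuous_at -(hf _ Nx) => C; apply: cvg_trans C.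
  exact: near_eq_cvg.
split=> [x /H[N [h [oN Nx hf [dh _]]]]|v].
  apply: (diff_near_eq _ (dh _ Nx)).1.
  by apply: filterS hf _; exact: open_nbhs_nbhs.
apply: IH => x /H[N [h [oN Nx hf [dh Nh]]]].
exists N, (fun x => 'd h x v); split=> [||y Ny|]; [exact: oN|exact: Nx| |exact: Nh].
have nN : \forall z \near y, h z = f z.
  by apply: filterS hf _; exact: open_nbhs_nbhs.
by have [_ ->] := diff_near_eq nN (dh _ Ny).
Qed.

Lemma Ck_on_eq V W k (U : set V) (f h : V -> W) : open U ->
  (forall x, U x -> f x = h x) -> Ck_on k U f -> Ck_on k U h.
Proof. by move=> oU fh Cf; apply: Ck_on_local => x Ux; exists U, f. Qed.

Lemma Ck_on_sub V W k (U U' : set V) (f : V -> W) :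
  U `<=` U' -> Ck_on k U' f -> Ck_on k U f.
Proof.
elim: k f => [|k IH] f UU' /=; first by move=> H x /UU'/H.
by move=> [H1 H2]; split=> [x /UU'/H1//|v]; exact: IH.
Qed.

Lemma Ck_onS V W k (U : set V) (f : V -> W) : Ck_on k.+1 U f -> Ck_on k U f.
Proof.
elim: k f => [|k IH] f /=.
  by move=> [df _] x Ux; exact/differentiable_continuous/df.
by move=> [df cdf]; split=> // v; exact: IH.
Qed.

Lemma Ck_on_cst V W k (U : set V) (a : W) : Ck_on k U (fun _ : V => a).
Proof.
elim: k a => [|k IH] a /=; first by move=> x _; exact: cst_continuous.
split=> [x _|v]; first exact: differentiable_cst.
rewrite (_ : (fun _ => _) = fun=> 0) //; apply/funext => x.
by rewrite -[fun _ : V => a]/(cst a) diff_cst.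
Qed.

Lemma Ck_on_linear V W k (U : set V) (f : {linear V -> W}) :
  continuous f -> Ck_on k U f.
Proof.
case: k => [|k] cf /=; first by move=> x _; exact: cf.
split=> [x _|v]; first exact: linear_differentiable.
rewrite (_ : (fun x => _) = fun=> f v); first exact: Ck_on_cst.
by apply/funext => x; rewrite diff_linE.
Qed.

Lemma Ck_onD V W k (U : set V) (f h : V -> W) : open U ->
  Ck_on k U f -> Ck_on k U h -> Ck_on k U (fun x => f x + h x).
Proof.
move=> oU; elim: k f h => [|k IH] f h /=.
  by move=> Cf Ch x Ux; apply: continuousD; [exact: Cf|exact: Ch].
move=> [df Cf] [dh Ch]; split=> [x Ux|v].
  by apply: differentiableD; [exact: df|exact: dh].
apply: (@Ck_on_eq _ _ _ _ (fun x => 'd f x v + 'd h x v)) => // [x Ux|].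
  by rewrite -[fun x => f x + h x]/(f + h) diffD; [|exact: df|exact: dh].
exact: IH.
Qed.

Lemma Ck_on_linear_comp V W Z k (U : set V) (f : V -> W) (l : {linear W -> Z}) :
  open U -> continuous l -> Ck_on k U f -> Ck_on k U (fun x => l (f x)).
Proof.
move=> oU cl; elim: k f => [|k IH] f /=.
  by move=> Cf x Ux; apply: continuous_comp; [exact: Cf|exact: cl].
have dl y : differentiable l y by exact: linear_differentiable.
move=> [df Cf]; split=> [x Ux|v]; first exact: (differentiable_comp (df x Ux)).
apply: (@Ck_on_eq _ _ _ _ (fun x => l ('d f x v))) => // [x Ux|].
  rewrite (@diff_compE _ _ _ f l); [|exact: df|exact: dl].
  by rewrite diff_linE.
exact: IH.
Qed.

Lemma Ck_on_sum V W k (U : set V) (I : Type) (r : seq I) (P : pred I)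
    (f : I -> V -> W) : open U -> (forall i, P i -> Ck_on k U (f i)) ->
  Ck_on k U (fun x => \sum_(i <- r | P i) f i x).
Proof.
move=> oU Cf; elim: r => [|i r IH].
  rewrite (_ : (fun _ => _) = fun=> 0); first exact: Ck_on_cst.
  by apply/funext => x; rewrite big_nil.
case Pi: (P i).
  rewrite (_ : (fun _ => _) = fun x => f i x + \sum_(i <- r | P i) f i x).
    by apply: Ck_onD => //; exact: Cf.
  by apply/funext => x; rewrite big_cons Pi.
rewrite (_ : (fun _ => _) = fun x => \sum_(i <- r | P i) f i x) //.
by apply/funext => x; rewrite big_cons Pi.
Qed.

(** The Leibniz rule, from the differential of the continuous bilinear map
    [(a, w) |-> a *: w]. *)
Lemma is_diff_scale V W (a : V -> R) (f : V -> W) x :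
  differentiable a x -> differentiable f x ->
  is_diff x (fun y => a y *: f y) (fun v => 'd a x v *: f x + a x *: 'd f x v).
Proof.
move=> da df.
pose b : R -> W -> W := fun a w => a *: w.
have bb : bilinear_for
    (GRing.Scale.Law.clone _ _ *:%R _) (GRing.Scale.Law.clone _ _ *:%R _) b.
  split=> [u'|u] c y z; rewrite /b /=; first by rewrite scalerDl scalerA.
  by rewrite scalerDr !scalerA mulrC.
pose bM := bilinear_isBilinear.Build R R W W _ _ b bb.
pose B : {bilinear R -> W -> W} := HB.pack b bM.
have cB : continuous (fun p : R * W => B p.1 p.2).
  by move=> p; exact: scale_continuous.
have -> : (fun y => a y *: f y) =
  (fun p : R * W => B p.1 p.2) \o (fun y => (a y, f y)) by [].
have dp : differentiable (fun y => (a y, f y)) x by exact: differentiable_pair.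
have dB : differentiable (fun p : R * W => B p.1 p.2) (a x, f x).
  exact: differentiable_bilin.
apply: DiffDef; first exact: differentiable_comp.
rewrite diff_comp // diff_pair // diff_bilin //.
by apply/funext => v /=; rewrite addrC.
Qed.

Lemma Ck_onZ V W k (U : set V) (a : V -> R) (f : V -> W) : open U ->
  Ck_on k U a -> Ck_on k U f -> Ck_on k U (fun x => a x *: f x).
Proof.
move=> oU; elim: k a f => [|k IH] a f.
  by move=> Ca Cf x Ux; apply: continuousZ; [exact: Ca|exact: Cf].
move=> Ca Cf; have [/= da Ca'] := Ca; have [/= df Cf'] := Cf.
have D x : U x -> is_diff x (fun y => a y *: f y)
    (fun v => 'd a x v *: f x + a x *: 'd f x v).
  by move=> Ux; apply: is_diff_scale; [exact: da|exact: df].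
split=> [x /D[]//|v].
apply: (@Ck_on_eq _ _ _ _ (fun x => 'd a x v *: f x + a x *: 'd f x v)) => //.
  by move=> x /D[_ ->].
apply: Ck_onD oU _ _; apply: IH.
- exact: Ca'.
- exact: Ck_onS.
- exact: Ck_onS.
- exact: Cf'.
Qed.

Lemma Ck_onM V k (U : set V) (a b : V -> R) : open U ->
  Ck_on k U a -> Ck_on k U b -> Ck_on k U (fun x => a x * b x).
Proof. exact: Ck_onZ. Qed.

Lemma Ck_on_prod V k (U : set V) (I : Type) (r : seq I) (a : I -> V -> R) :
  open U -> (forall i, Ck_on k U (a i)) ->
  Ck_on k U (fun x => \prod_(i <- r) a i x).
Proof.
move=> oU Ca; elim: r => [|i r IH].
  rewrite (_ : (fun _ => _) = fun=> 1); first exact: Ck_on_cst.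
  by apply/funext => x; rewrite big_nil.
rewrite (_ : (fun _ => _) = fun x => a i x * \prod_(i <- r) a i x).
  by apply: Ck_onM; [exact: oU|exact: Ca|exact: IH].
by apply/funext => x; rewrite big_cons.
Qed.

(** Induction on [k]: the differential of [1 / a] is [- da / a ^ 2], again built
    from [a], its differential and inverses. *)
Lemma Ck_on_inv V k (U : set V) (a : V -> R) : open U ->
  (forall x, U x -> a x != 0) -> Ck_on k U a -> Ck_on k U (fun x => (a x)^-1).
Proof.
move=> oU a0; elim: k => [|k IH].
  by move=> Ca x Ux; apply: (@continuousV R V a x) (a0 x Ux) (Ca x Ux).
move=> Ca; have [/= da Ca'] := Ca; have {}IH := IH (Ck_onS Ca).
split=> [x Ux|v].
  apply: (@differentiable_comp _ _ _ _ a GRing.inv); first exact: da.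
  exact/differentiable_Rinv/a0.
apply: (@Ck_on_eq _ _ _ _ (fun x => -1 * (((a x)^-1 * (a x)^-1) * 'd a x v))) => //.
  move=> x Ux.
  rewrite (@diff_compE _ _ _ a GRing.inv); [|exact: da|exact/differentiable_Rinv/a0].
  have dV : ('d GRing.inv (a x) : R -> R) = (fun h : R => - (a x) ^- 2 *: h).
    exact/diff_Rinv/a0.
  by rewrite dV expr2 invfM /GRing.scale /= mulN1r mulNr.
apply: Ck_onM => //; first exact: Ck_on_cst.
by apply: Ck_onM; [exact: oU|exact: Ck_onM|exact: Ca'].
Qed.

End SmoothMaps.

(** * Coordinates, composition and inversion of smooth families *)

Section FiniteDimension.
Context {R : realType}.
Implicit Types V W Z : normedModType R.

(** Continuity of the coordinates is part of the notion: it is what makes every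
    linear map continuous. *)
Definition finite_dim W : Prop :=
  exists m (e : 'I_m -> W) (c : 'I_m -> {linear W -> R}),
    [/\ forall i, continuous (c i), forall i j, c i (e j) = (i == j)%:R &
        forall w, w = \sum_i c i w *: e i].

(** For maps given by formulas, which the theory of bundled linear maps does not
    see. *)
Lemma linear_packed V W (f : V -> W) :
  (forall (a : R) u v, f (a *: u + v) = a *: f u + f v) ->
  exists l : {linear V -> W}, l = f :> (V -> W).
Proof.
move=> lf.
pose fM := GRing.isLinear.Build _ _ _ _ f lf.
pose l : {linear V -> W} := HB.pack f fM.
by exists l.
Qed.

Lemma finite_dim_continuous V W (l : {linear V -> W}) :
  finite_dim V -> continuous l.
Proof.
move=> [m [e [c [cc _ ec]]]].
have -> : (l : V -> W) = fun v => \sum_i c i v *: l (e i).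
  apply/funext => v; rewrite [in LHS](ec v) linear_sum.
  by apply: eq_bigr => i _; rewrite linearZ.
move=> v; apply: (@cvg_big _ _ +%R) => [|i _]; first exact: add_continuous.
by apply: cvgZr_tmp; exact: cc.
Qed.

(** Expanding the vector in a basis leaves products of scalar functions and
    vector-valued functions. *)
Lemma Ck_on_family V W Z k (U : set V) (A : V -> W -> Z) (w : V -> W) :
  finite_dim W -> open U ->
  (forall x, U x -> forall (a : R) u v, A x (a *: u + v) = a *: A x u + A x v) ->
  (forall u, Ck_on k U (fun x => A x u)) -> Ck_on k U w ->
  Ck_on k U (fun x => A x (w x)).
Proof.
move=> [m [e [c [cc _ ec]]]] oU lA CA Cw.
apply: (@Ck_on_eq _ _ _ _ _ (fun x => \sum_i c i (w x) *: A x (e i))) => //.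
  move=> x Ux; have [l lE] := linear_packed (lA x Ux).
  rewrite -lE [in RHS](ec (w x)) linear_sum.
  by apply: eq_bigr => i _; rewrite linearZ.
apply: Ck_on_sum => // i _; apply: Ck_onZ => //.
exact: Ck_on_linear_comp.
Qed.

Lemma Ck_on_bilinear V W (W' : normedModType R) Z k (U : set V) (b : W -> W' -> Z)
    (f : V -> W) (g : V -> W') :
  finite_dim W -> finite_dim W' -> open U ->
  (forall w (a : R) u v, b w (a *: u + v) = a *: b w u + b w v) ->
  (forall w (a : R) u v, b (a *: u + v) w = a *: b u w + b v w) ->
  Ck_on k U f -> Ck_on k U g -> Ck_on k U (fun x => b (f x) (g x)).
Proof.
move=> fW fW' oU br bl Cf Cg.
apply: (@Ck_on_family _ _ _ _ _ (fun x => b (f x)) g) => // u.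
have [l lE] := linear_packed (bl u).
rewrite (_ : (fun x => b (f x) u) = fun x => l (f x)); last by rewrite lE.
by apply: Ck_on_linear_comp => //; exact: finite_dim_continuous.
Qed.

(** Induction on [k]: [d(g o f)_x v = dg_{f x} (df_x v)] is a family of linear maps
    applied to a vector, hence the need for a finite-dimensional middle space. *)
Lemma Ck_on_comp V W Z k (U : set V) (U' : set W) (f : V -> W) (g : W -> Z) :
  finite_dim W -> open U -> open U' -> (forall x, U x -> U' (f x)) ->
  Ck_on k U f -> Ck_on k U' g -> Ck_on k U (fun x => g (f x)).
Proof.
move=> fW oU oU' UU'; elim: k g => [|k IH] g.
  move=> Cf Cg x Ux; apply: (@continuous_comp _ _ _ f g); first exact: Cf.
  exact/Cg/UU'.
move=> Cf Cg; have [/= df Cf'] := Cf; have [/= dg Cg'] := Cg.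
split=> [x Ux|v].
  by apply: (differentiable_comp (df x Ux)); exact/dg/UU'.
apply: (@Ck_on_eq _ _ _ _ _ (fun x => 'd g (f x) ('d f x v))) => //.
  move=> x Ux; rewrite (@diff_compE _ _ _ _ f g) //; first exact: df.
  exact/dg/UU'.
apply: (@Ck_on_family _ _ _ _ _ (fun x => 'd g (f x)) (fun x => 'd f x v)) => //.
- by move=> x _ a u w; rewrite linearP.
- by move=> u; apply: (IH (fun y => 'd g y u)); [exact: Ck_onS|exact: Cg'].
- exact: Cf'.
Qed.

Lemma Ck_on_det V k (U : set V) m (A : V -> 'M[R]_m) : open U ->
  (forall i j, Ck_on k U (fun x => A x i j)) -> Ck_on k U (fun x => \det (A x)).
Proof.
move=> oU CA; rewrite /determinant; apply: Ck_on_sum => // s _.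
apply: Ck_onM => //; first exact: Ck_on_cst.
exact: Ck_on_prod.
Qed.

Lemma Ck_on_invmx V k (U : set V) m (A : V -> 'M[R]_m) : open U ->
  (forall x, U x -> A x \in unitmx) ->
  (forall i j, Ck_on k U (fun x => A x i j)) ->
  forall i j, Ck_on k U (fun x => invmx (A x) i j).
Proof.
move=> oU uA CA i j.
pose b x : R := (\det (A x))^-1 * cofactor (A x) j i.
apply: (@Ck_on_eq _ _ _ _ _ b); first exact: oU.
  by move=> x Ux; rewrite /invmx uA // !mxE.
apply: Ck_onM => //.
  apply: Ck_on_inv => //; last exact: Ck_on_det.
  by move=> x /uA; rewrite unitmxE unitfE.
rewrite /cofactor; apply: Ck_onM => //; first exact: Ck_on_cst.
apply: Ck_on_det => // i' j'.
rewrite (_ : (fun x => _) = fun x => A x (lift j i') (lift i j')); first exact: CA.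
by apply/funext => x; rewrite !mxE.
Qed.

Section Coordinates.
Context {W : normedModType R} {m : nat} {e : 'I_m -> W} {c : 'I_m -> {linear W -> R}}.
Hypotheses (ce : forall i j, c i (e j) = (i == j)%:R)
  (ec : forall w, w = \sum_i c i w *: e i).

Let coords (w : W) : 'rV[R]_m := \row_i c i w.
Let mat (f : W -> W) : 'M[R]_m := \matrix_(i, j) c j (f (e i)).

Let coords_sum (u : 'rV[R]_m) : coords (\sum_i u 0 i *: e i) = u.
Proof.
apply/rowP => j; rewrite mxE linear_sum (bigD1 j) //= linearZ /= ce eqxx.
rewrite [X in _ + X]big1 ?addr0; first by rewrite /GRing.scale /= mulr1.
by move=> i ij; rewrite linearZ /= ce eq_sym (negbTE ij) /GRing.scale /= mulr0.
Qed.

Let coords_inj w w' : coords w = coords w' -> w = w'.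
Proof.
move=> /rowP ww'; rewrite (ec w) (ec w'); apply: eq_bigr => i _.
by have := ww' i; rewrite !mxE => ->.
Qed.

Let coords_mat (l : {linear W -> W}) w : coords (l w) = coords w *m mat l.
Proof.
apply/rowP => j; rewrite !mxE [in LHS](ec w) linear_sum linear_sum.
by apply: eq_bigr => i _; rewrite !linearZ /= !mxE.
Qed.

Let mat_unit (l : {linear W -> W}) : injective l -> mat l \in unitmx.
Proof.
move=> li; rewrite -row_free_unit -kermx_eq0; apply/eqP/row_matrixP => i.
rewrite row0; set u := row i _.
have : u *m mat l = 0 by rewrite /u -row_mul mulmx_ker row0.
rewrite -(coords_sum u) -coords_mat => l0.
have w0 : l (\sum_i u 0 i *: e i) = l 0.
  by apply: coords_inj; rewrite l0 linear0; apply/rowP => j; rewrite !mxE linear0.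
by rewrite (li _ _ w0); apply/rowP => j; rewrite !mxE linear0.
Qed.

(** Cramer's rule in coordinates. *)
Let linear_preimage (l : {linear W -> W}) w : injective l ->
  l (\sum_i (coords w *m invmx (mat l)) 0 i *: e i) = w.
Proof.
move=> /mat_unit ml.
by apply: coords_inj; rewrite coords_mat coords_sum mulmxKV.
Qed.

Lemma linear_inj_surj_coords (l : {linear W -> W}) w : injective l ->
  exists w', l w' = w.
Proof. by move=> /linear_preimage lw; eexists; exact: lw. Qed.

Lemma Ck_on_inverse_coords V k (U : set V) (A B : V -> W -> W) : open U ->
  (forall x, U x -> forall (a : R) u v, A x (a *: u + v) = a *: A x u + A x v) ->
  (forall x, U x -> cancel (A x) (B x)) ->
  (forall i, continuous (c i)) ->
  (forall u, Ck_on k U (fun x => A x u)) ->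
  forall u, Ck_on k U (fun x => B x u).
Proof.
move=> oU lA AB cc CA u.
have CM i j : Ck_on k U (fun x => mat (A x) i j).
  rewrite (_ : (fun x => _) = fun x => c j (A x (e i))).
    by apply: Ck_on_linear_comp => //; exact: CA.
  by apply/funext => x; rewrite mxE.
apply: (@Ck_on_eq _ _ _ _ _
    (fun x => \sum_i (\sum_j c j u * invmx (mat (A x)) j i) *: e i)) => //.
  move=> x Ux; have [l lE] := linear_packed (lA x Ux).
  have AxB : cancel l (B x) by rewrite lE; exact: AB.
  rewrite -[in RHS](linear_preimage u (can_inj AxB)) AxB lE.
  apply: eq_bigr => i _; congr (_ *: _); rewrite mxE.
  by apply: eq_bigr => j _; rewrite mxE.
apply: Ck_on_sum => // i _; apply: Ck_onZ => //; last exact: Ck_on_cst.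
apply: Ck_on_sum => // j _; apply: Ck_onM => //; first exact: Ck_on_cst.
apply: Ck_on_invmx => // x Ux.
have [l lE] := linear_packed (lA x Ux); rewrite -lE.
by apply: mat_unit; apply: (can_inj (g := B x)); rewrite lE; exact: AB.
Qed.

End Coordinates.

Lemma linear_inj_surj W (l : {linear W -> W}) (w : W) :
  finite_dim W -> injective l -> exists w', l w' = w.
Proof. by move=> [m [e [c [_ ce ec]]]]; exact: linear_inj_surj_coords. Qed.

(** By Cramer's rule the matrices of the inverses are quotients of polynomials in
    smooth functions. *)
Lemma Ck_on_inverse_family V W k (U : set V) (A B : V -> W -> W) :
  finite_dim W -> open U ->
  (forall x, U x -> forall (a : R) u v, A x (a *: u + v) = a *: A x u + A x v) ->
  (forall x, U x -> cancel (A x) (B x)) ->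
  (forall u, Ck_on k U (fun x => A x u)) ->
  forall u, Ck_on k U (fun x => B x u).
Proof.
move=> [m [e [c [cc ce ec]]]] oU lA AB CA.
exact: (Ck_on_inverse_coords ce ec oU lA AB cc CA).
Qed.

Lemma finite_dim_scalar : finite_dim R.
Proof.
exists 1%N, (fun _ => 1), (fun _ => idfun); split.
- by move=> _ x; exact: cvg_id.
- by move=> i j; rewrite !ord1 eqxx.
- by move=> w; rewrite big_ord1 /= /GRing.scale /= mulr1.
Qed.

Lemma finite_dim_row n : finite_dim 'rV[R]_n.
Proof.
have lc (i : 'I_n) (a : R) (u v : 'rV[R]_n) :
  (a *: u + v) 0 i = a *: (u 0 i : R) + v 0 i by rewrite !mxE.
have /choice [c cE] : forall i : 'I_n, exists l : {linear 'rV[R]_n -> R},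
    l = (fun u => u 0 i) :> (_ -> _).
  by move=> i; exact: linear_packed (lc i).
exists n, (fun i => delta_mx 0 i), c; split.
- by move=> i; rewrite cE; exact: coord_continuous.
- by move=> i j; rewrite cE mxE eqxx.
- move=> w; rewrite [LHS]row_sum_delta; apply: eq_bigr => i _.
  by rewrite cE.
Qed.

Lemma finite_dim_prod V W : finite_dim V -> finite_dim W -> finite_dim (V * W)%type.
Proof.
move=> [m [e [c [cc ce ec]]]] [m' [e' [c' [cc' ce' ec']]]].
pose cs (i : 'I_(m + m')) (x : V * W) : R :=
  match fintype.split i with inl j => c j x.1 | inr j => c' j x.2 end.
have lcs i (a : R) u v : cs i (a *: u + v) = a *: cs i u + cs i v.
  by rewrite /cs; case: (fintype.split i) => j; rewrite linearP.
have /choice [d dE] : forall i, exists l : {linear (V * W)%type -> R},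
    l = cs i :> (_ -> _).
  by move=> i; exact: linear_packed (lcs i).
exists (m + m')%N, (fun i =>
  match fintype.split i with inl j => (e j, 0) | inr j => (0, e' j) end), d.
split=> [i|i j|[v w]].
- rewrite dE /cs => x; case: (fintype.split i) => j.
    by apply: (@continuous_comp _ _ _ fst (c j)); [exact: cvg_fst|exact: cc].
  by apply: (@continuous_comp _ _ _ snd (c' j)); [exact: cvg_snd|exact: cc'].
- rewrite dE /cs -[X in X == _](splitK i) -[X in _ == X](splitK j).
  case: (fintype.split i) => i'; case: (fintype.split j) => j' /=; rewrite ?linear0 ?ce ?ce'.
  + by rewrite /unsplit eq_lshift.
  + by rewrite /unsplit eq_lrshift.
  + by rewrite /unsplit eq_rlshift.
  + by rewrite /unsplit eq_rshift.
- rewrite big_split_ord /=.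
  under eq_bigr => i _ do rewrite dE /cs (unsplitK (inl i)) /=.
  under [X in _ + X]eq_bigr => i _ do rewrite dE /cs (unsplitK (inr i)) /=.
  have fstS q (F : 'I_q -> V * W) : (\sum_i F i).1 = \sum_i (F i).1.
    exact: (big_morph fst (fun _ _ => erefl) erefl).
  have sndS q (F : 'I_q -> V * W) : (\sum_i F i).2 = \sum_i (F i).2.
    exact: (big_morph snd (fun _ _ => erefl) erefl).
  apply/pair_equal_spec; split.
    rewrite -[RHS]/(_ .1 + _ .1) !fstS /= [X in _ + X]big1 ?addr0 => [|i _].
      exact: ec.
    by rewrite scaler0.
  rewrite -[RHS]/(_ .2 + _ .2) !sndS /= [X in X + _]big1 ?add0r => [|i _].
    exact: ec'.
  by rewrite scaler0.
Qed.

End FiniteDimension.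

(** * The Heisenberg group and its automorphisms *)

Section HeisenbergGroup.
Context {R : realType} {n : nat}.
Local Notation h := (heis R n).
Implicit Types U V W g k l : h.

Lemma finite_dim_heis : finite_dim h.
Proof.
apply: finite_dim_prod; last exact: finite_dim_scalar.
by apply: finite_dim_prod; exact: finite_dim_row.
Qed.

Lemma finite_dim_space : finite_dim (R * h)%type.
Proof. exact: finite_dim_prod finite_dim_scalar finite_dim_heis. Qed.

Lemma bracketC U V : bracket V U = - bracket U V.
Proof.
rewrite /bracket; apply/pair_equal_spec; split=> /=; first by rewrite oppr0.
by rewrite -sumrN; apply: eq_bigr => i _; ring.
Qed.

Lemma bracket_linearl (a : R) U V W :
  bracket (a *: U + V) W = a *: bracket U W + bracket V W.
Proof.
rewrite /bracket; apply/pair_equal_spec; split=> /=; first by rewrite scaler0 addr0.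
rewrite /GRing.scale /= mulr_sumr -big_split /=; apply: eq_bigr => i _.
by rewrite !mxE; ring.
Qed.

Lemma bracketDl U V W : bracket (U + V) W = bracket U W + bracket V W.
Proof. by have := bracket_linearl 1 U V W; rewrite !scale1r. Qed.

Lemma bracket0l W : bracket 0 W = 0.
Proof. by apply: (@addrI _ (bracket 0 W)); rewrite -bracketDl !addr0. Qed.

Lemma bracketZl a U W : bracket (a *: U) W = a *: bracket U W.
Proof. by rewrite -[a *: U]addr0 bracket_linearl bracket0l addr0. Qed.

Lemma bracketNl U W : bracket (- U) W = - bracket U W.
Proof. by rewrite -scaleN1r bracketZl scaleN1r. Qed.

Lemma bracketDr U V W : bracket W (U + V) = bracket W U + bracket W V.
Proof. by rewrite !(bracketC _ W) bracketDl opprD. Qed.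

Lemma bracketZr a U W : bracket W (a *: U) = a *: bracket W U.
Proof. by rewrite !(bracketC _ W) bracketZl scalerN. Qed.

Lemma bracketNr U W : bracket W (- U) = - bracket W U.
Proof. by rewrite -scaleN1r bracketZr scaleN1r. Qed.

Lemma bracket0r W : bracket W 0 = 0.
Proof. by rewrite bracketC bracket0l oppr0. Qed.

Lemma bracketxx U : bracket U U = 0.
Proof.
rewrite /bracket; apply/pair_equal_spec; split=> //=.
by rewrite big1 // => i _; ring.
Qed.

Lemma bracket_Zl a V : bracket ((0, 0), a) V = 0.
Proof.
rewrite /bracket; apply/pair_equal_spec; split=> //=.
by rewrite big1 // => i _; rewrite !mxE; ring.
Qed.

Lemma bracket_bracketl U V W : bracket (bracket U V) W = 0.
Proof. exact: bracket_Zl. Qed.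

Lemma bracket_bracketr U V W : bracket W (bracket U V) = 0.
Proof. by rewrite bracketC bracket_bracketl oppr0. Qed.

Lemma hmulE g k : hmul g k = k + (g + 2^-1 *: bracket k g).
Proof. by rewrite /hmul (bracketC k g) scalerN opprK addrA (addrC g). Qed.

Lemma hmul0g g : hmul 0 g = g.
Proof. by rewrite /hmul bracket0l scaler0 add0r subr0. Qed.

Lemma hmulg0 g : hmul g 0 = g.
Proof. by rewrite /hmul bracket0r scaler0 addr0 subr0. Qed.

Lemma hmulgN g : hmul g (- g) = 0.
Proof. by rewrite /hmul bracketNr bracketxx oppr0 scaler0 subrr subr0. Qed.

Lemma hmulNg g : hmul (- g) g = 0.
Proof. by rewrite /hmul bracketNl bracketxx oppr0 scaler0 addNr subr0. Qed.

Lemma hmulA g k l : hmul g (hmul k l) = hmul (hmul g k) l.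
Proof.
rewrite /hmul !(bracketDl, bracketDr, bracketNl, bracketNr, bracketZl, bracketZr).
rewrite bracket_bracketl bracket_bracketr !scaler0 !oppr0 !addr0.
rewrite !scalerDr !opprD !addrA.
by rewrite [RHS](ACl (1*2*4*6*3*5))%AC.
Qed.

Lemma hmulKg g k : hmul (- g) (hmul g k) = k.
Proof. by rewrite hmulA hmulNg hmul0g. Qed.

Lemma hmulKNg g k : hmul g (hmul (- g) k) = k.
Proof. by rewrite hmulA hmulgN hmul0g. Qed.

Lemma hmul_scale (a b : R) U : hmul (a *: U) (b *: U) = (a + b) *: U.
Proof.
by rewrite /hmul bracketZl bracketZr bracketxx !scaler0 subr0 scalerDl.
Qed.

Lemma hmul_comm_bracket g k : hmul g k = hmul k g -> bracket g k = 0.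
Proof.
rewrite /hmul (addrC k) (bracketC g k) => /addrI /oppr_inj.
rewrite scalerN => /eqP; rewrite -addr_eq0 -scalerDl => /eqP.
have -> : 2^-1 + 2^-1 = 1 :> R by field.
by rewrite scale1r.
Qed.

Lemma bracket_linearr (a : R) U V W :
  bracket W (a *: U + V) = a *: bracket W U + bracket W V.
Proof. by rewrite bracketDr bracketZr. Qed.

Lemma Ck_on_bracket (V : normedModType R) m (A : set V) (f g : V -> h) : open A ->
  Ck_on m A f -> Ck_on m A g -> Ck_on m A (fun x => bracket (f x) (g x)).
Proof.
move=> oA; apply: Ck_on_bilinear => //; try exact: finite_dim_heis.
  by move=> w a u v; exact: bracket_linearr.
by move=> w a u v; exact: bracket_linearl.
Qed.

Lemma Ck_on_hmul (V : normedModType R) m (A : set V) (f g : V -> h) : open A ->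
  Ck_on m A f -> Ck_on m A g -> Ck_on m A (fun x => hmul (f x) (g x)).
Proof.
move=> oA Cf Cg; apply: Ck_onD => //; first exact: Ck_onD.
have [l lE] : exists l : {linear h -> h}, l = (fun u => - (2^-1 *: u)) :> (h -> h).
  apply: linear_packed => a u v.
  by rewrite !scalerDr opprD scalerN !scalerA (mulrC a).
rewrite (_ : (fun x => _) = fun x => l (bracket (f x) (g x))); last by rewrite lE.
apply: Ck_on_linear_comp => //; first exact/finite_dim_continuous/finite_dim_heis.
exact: Ck_on_bracket.
Qed.

Lemma hmul_continuous : continuous (fun x : h * h => hmul x.1 x.2).
Proof.
have C : Ck_on 0 setT (fun x : h * h => hmul x.1 x.2).
  apply: Ck_on_hmul => [|y _|y _]; first exact: openT; first exact: cvg_fst.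
  exact: cvg_snd.
by move=> x; exact: C.
Qed.

Lemma continuous_hmul (T : topologicalType) (f k : T -> h) (x : T) :
  {for x, continuous f} -> {for x, continuous k} ->
  {for x, continuous (fun y => hmul (f y) (k y))}.
Proof.
move=> cf ck.
apply: (@continuous_comp _ _ _ (fun y => (f y, k y)) (fun x : h * h => hmul x.1 x.2)).
  exact: cvg_pair cf ck.
exact: hmul_continuous.
Qed.

(** Commuting elements multiply by addition in exponential coordinates, so [f] is
    additive along each line and [f U = m (f (U / m))]; as [m] tends to infinity
    the right-hand side tends to ['d f 0 U].  In particular [f] is linear. *)
Lemma lie_aut_diff (f : h -> h) : lie_aut f -> 'd f 0 = f :> (h -> h).
Proof.
move=> [fM [_ _ sf _]].
have [/(_ 0 I) df _] := sf 1%N.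
have f0 : f 0 = 0.
  apply: (can_inj (hmulKg (f 0))); rewrite -fM hmul0g hmulg0; last by [].
have fadd (a b : R) U : f ((a + b) *: U) = f (a *: U) + f (b *: U).
  have := hmul_scale a b U => /(congr1 f); rewrite fM => fab.
  have := hmul_scale b a U => /(congr1 f); rewrite fM addrC => fba.
  rewrite -fab /hmul hmul_comm_bracket ?scaler0 ?subr0 //.
  by rewrite fab fba.
have fnat m (a : R) U : f ((a *+ m) *: U) = f (a *: U) *+ m.
  elim: m => [|m IH]; first by rewrite !mulr0n scale0r f0.
  by rewrite !mulrSr fadd IH.
apply/funext => U; apply/eqP; rewrite -subr_eq0 -normr_le0.
apply/ler_addgt0Pr => e e0; rewrite add0r.
have [_] := (diff_locallyP 0 f).1 df.
rewrite f0 (_ : f \o shift 0 = f) => [/eqaddoP E|]; last first.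
  by apply/funext => y /=; rewrite addr0.
have d0 : 0 < e / (`|U| + 1) by rewrite divr_gt0 // ltr_wpDl.
have hU : (fun m => harmonic m *: U) @ \oo --> (0 : h).
  by rewrite -(scale0r U); apply: cvgZr_tmp; exact: cvg_harmonic.
(* The factor 1 / (|U| + 1) absorbs the norm of [U] in the final estimate. *)
pose P (y : h) : Prop := `|f y - 'd f 0 y| <= e / (`|U| + 1) * `|y|.
have P0 : nbhs (0 : h) P.
  apply: filterS (E _ d0) => y.
  by rewrite -[(f - _) y]/(f y - (0 + 'd f 0 y)) add0r.
have /filter_ex[m Hm] : \forall m \near \oo, P (harmonic m *: U).
  exact: hU P0.
have hm1 : harmonic m *+ m.+1 = 1 :> R.
  by rewrite -[LHS]mulr_natr mulVf // pnatr_eq0.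
have UE : (harmonic m *+ m.+1) *: U = U.
  by rewrite hm1 scale1r.
have dUE : 'd f 0 U = 'd f 0 (harmonic m *: U) *+ m.+1.
  by rewrite -[in LHS]UE -linearMn scalerMnl.
rewrite distrC -[U in f U]UE fnat dUE -mulrnBl normrMn.
apply: (le_trans (ler_wMn2r m.+1 Hm)).
rewrite normrZ ger0_norm ?harmonic_ge0 // -mulrnAr -mulrnAl hm1 mul1r.
rewrite mulrAC ler_pdivrMr ?ltr_wpDl //.
by rewrite ler_wpM2l ?lerDl // ltW.
Qed.

Lemma lie_aut_linear (f : h -> h) : lie_aut f ->
  forall (a : R) U V, f (a *: U + V) = a *: f U + f V.
Proof.
by move=> fA a U V; rewrite -(lie_aut_diff fA) linearP.
Qed.

(** Compare the brackets on both sides of [f (g k) = (f g) (f k)] for [f] linear. *)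
Lemma lie_aut_bracket (f : h -> h) : lie_aut f ->
  forall U V, f (bracket U V) = bracket (f U) (f V).
Proof.
move=> fA U V; have [fM _] := fA; have lf := lie_aut_linear fA.
have [l lE] := linear_packed lf.
have := fM U V; rewrite /hmul -lE linearB linearD linearZ /=.
by move=> /addrI /oppr_inj /(scalerI _) ->.
Qed.

Lemma lie_aut_inj (f : h -> h) : lie_aut f -> injective f.
Proof.
move=> [_ [_ _ _ [g [_ gf _]]]]; apply: (can_inj (g := g)) => x.
by have [] := gf x I.
Qed.

End HeisenbergGroup.

(** * Orbit spaces *)

Section OrbitSpace.
Context {R : realType} {T : normedModType R} (orb : T -> set T).

Lemma orbit_proj_eq x y : orbit_proj orb x = orbit_proj orb y <-> orb x = orb y.
Proof.
split=> [xy|xy]; last by apply/eqquotP; exact/asboolP.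
by apply/asboolP; move/eqquotP: xy.
Qed.

Lemma orbit_proj_surj (q : orbit_space orb) : exists x, orbit_proj orb x = q.
Proof. by exists (repr q); exact: reprK. Qed.

Lemma open_orbit_space (A : set (orbit_space orb)) :
  open A <-> open (orbit_proj orb @^-1` A).
Proof. by []. Qed.

Lemma orbit_proj_continuous : continuous (orbit_proj orb).
Proof. exact: pi_continuous. Qed.

End OrbitSpace.

(** * Lattices of the Heisenberg group are cocompact *)

Section Cocompactness.
Context {R : realType} {n : nat}.
Local Notation h := (heis R n).

Section LatticeCharacters.
Context (L : set h).
Hypothesis (lL : lattice L).

(** Let [B t] be the image in [H / L] of the set where [ell < t].  Translation by
    [k] with [ell k = 1] maps [B t] onto [B (t + 1)], so all the [B m], for [m]
    an integer, have the same finite measure.  They increase to the whole space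
    and decrease to the empty set, which forces the total mass to vanish. *)
Lemma lattice_character (ell : h -> R) : continuous ell ->
  (forall g k, ell (hmul g k) = ell g + ell k) ->
  (forall l, L l -> ell l = 0) -> forall k, ell k != 1.
Proof.
move=> cell ellM ell0 k; apply/eqP => k1.
have [[L0 _ _] _ [mu [mu0 muoo muT]]] := lL.
pose X := g_sigma_algebraType (@open (orbit_space (left_coset L))).
pose pr : h -> X := orbit_proj (left_coset L).
have cosetE g k' : pr g = pr k' -> ell g = ell k'.
  move=> /orbit_proj_eq gk.
  have : left_coset L g g by exists 0 => //; rewrite hmulg0.
  by rewrite gk => -[l Ll <-]; rewrite ellM (ell0 _ Ll) addr0.
pose B (t : R) : set X := pr @` [set g | ell g < t].
have preB t : pr @^-1` B t = [set g | ell g < t].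
  apply/seteqP; split=> g /=; last by move=> gt; exists g.
  by case=> k' /= k't /cosetE <-.
have inB t g : B t (pr g) <-> ell g < t.
  by rewrite -[B t (pr g)]/((pr @^-1` B t) g) preB.
have mB t : measurable (B t).
  have : open [set g | ell g < t].
    have -> : [set g | ell g < t] = ell @^-1` [set s | s < t] by [].
    by apply: open_comp; [move=> g _; exact: cell|exact: open_lt].
  by rewrite -(preB t) => oB; apply: sub_sigma_algebra; apply/open_orbit_space.
have muB t : mu (B (t + 1)) = mu (B t).
  rewrite -(muT k (B t) (mB t)); congr (mu _).
  apply/seteqP; split=> q /=.
    move=> [g /= gt <-]; exists (hmul (- k) g); last by rewrite hmulKNg.
    apply/inB; move: gt.
    have := ellM k (- k); rewrite hmulgN k1.
    have := ellM 0 0; rewrite hmul0g.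
    by rewrite ellM; lra.
  move=> [g] /inB gt <-; exists (hmul k g) => //=.
  by rewrite ellM k1; lra.
have muBn (m : nat) : mu (B m%:R) = mu (B 0).
  by elim: m => // m IH; rewrite -IH -natr1 muB.
have muBN (m : nat) : mu (B (- m%:R)) = mu (B 0).
  by elim: m => [|m IH]; rewrite ?oppr0 // -IH -natr1 opprD -(muB (_ - 1)) subrK.
have Bmono s t : s <= t -> B s `<=` B t.
  by move=> st _ [g /= gs <-]; exists g => //=; exact: lt_le_trans gs st.
have UB : \bigcup_m B m%:R = setT.
  apply/seteqP; split=> // q _; have [g <-] := orbit_proj_surj q.
  exists (Num.truncn `|ell g|).+1 => //; exists g => //=.
  by apply: le_lt_trans (ler_norm _) _; exact: truncnS_gt.
have IB : \bigcap_m B (- m%:R) = set0.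
  apply/seteqP; split=> // q; have [g <-] := orbit_proj_surj q.
  move=> /(_ (Num.truncn `|ell g|).+1 I) [k' /= k't /cosetE gk]; move: k't.
  rewrite gk ltNge => /negP; apply.
  rewrite lerNl; apply: le_trans (ltW (truncnS_gt _)).
  by rewrite -normrN; exact: ler_norm.
have muTB : mu setT = mu (B 0).
  rewrite -UB.
  have := @nondecreasing_cvg_mu _ _ _ mu (fun m => B m%:R) (fun m => mB _).
  rewrite UB => /(_ measurableT) H.
  have {}H := H _; apply: (cvg_unique _ (H _)) => //.
    by apply/nondecreasing_seqP => m; apply/subsetPset/Bmono; rewrite ler_nat.
  rewrite (_ : mu \o _ = fun=> mu (B 0)); first exact: cvg_cst.
  by apply/funext => m /=; exact: muBn.
have mu00 : mu (B 0) = 0%E.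
  have := @nonincreasing_cvg_mu _ _ _ mu (fun m => B (- m%:R)).
  rewrite IB measure0 => H.
  have {}H := H _ (fun m => mB _) _ _; apply: (cvg_unique _ _ (H _ _ _)) => //.
  - rewrite (_ : mu \o _ = fun=> mu (B 0)); first exact: cvg_cst.
    by apply/funext => m /=; exact: muBN.
  - by rewrite muBN -muTB.
  - by apply/nonincreasing_seqP => m; apply/subsetPset/Bmono; rewrite lerN2 ler_nat.
by move: mu0; rewrite muTB mu00 ltxx.
Qed.

(** A linear form that kills the brackets is a character of the group, and a
    nonzero form can be rescaled to take the value 1. *)
Lemma lattice_linear_form (ell : {linear h -> R}) :
  (forall U V, ell (bracket U V) = 0) ->
  (forall l, L l -> ell l = 0) -> forall k, ell k = 0.
Proof.
move=> ellZ ell0 k; apply/eqP; apply: contraT => k0.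
have cell : continuous ell by exact/finite_dim_continuous/finite_dim_heis.
have ellM g k' : ell (hmul g k') = ell g + ell k'.
  by rewrite /hmul linearB linearD linearZ /= ellZ scaler0 subr0.
have /eqP[] := lattice_character cell ellM ell0 ((ell k)^-1 *: k).
by rewrite linearZ /= /GRing.scale /= mulVf.
Qed.

(** If all brackets of elements of [L] vanish, two applications of
    [lattice_linear_form], one for each argument, show that the bracket is zero,
    against [[X_0, Y_0] = Z]. *)
Lemma lattice_noncommuting : (0 < n)%N ->
  exists l l', [/\ L l, L l' & (bracket l l').2 != 0].
Proof.
move=> n0; apply/not_existsP => H.
have L0 l l' : L l -> L l' -> (bracket l l').2 = 0.
  move=> Ll Ll'; apply/eqP; apply: contraT => ll'.
  by case: (H l); exists l'.
have [ad adE] : exists f : h -> {linear h -> R}, forall U V, f U V = (bracket U V).2.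
  have /choice[f fE] : forall U, exists f : {linear h -> R},
      f = (fun V => (bracket U V).2) :> (h -> R).
    by move=> U; apply: linear_packed => a V W; rewrite bracket_linearr.
  by exists f => U V; rewrite fE.
have adZ U V W : ad U (bracket V W) = 0 by rewrite adE bracket_bracketr.
have L1 (l U : h) : L l -> (bracket l U).2 = 0.
  move=> Ll; suff : ad l U = 0 by rewrite adE.
  apply: lattice_linear_form => // l' Ll'.
  by rewrite adE; exact: L0.
have L2 (U V : h) : (bracket U V).2 = 0.
  suff : ad U V = 0 by rewrite adE.
  apply: lattice_linear_form => // l Ll.
  by rewrite adE bracketC -[LHS]/(- (bracket l U).2) L1 ?oppr0.
pose i0 := Ordinal n0.
have := L2 ((delta_mx 0 i0, 0), 0) ((0, delta_mx 0 i0), 0).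
rewrite /bracket /= (bigD1 i0) //= big1 ?addr0; last first.
  by move=> i ii0; rewrite !mxE (negbTE ii0) /= mulr0 subr0.
by rewrite !mxE !eqxx /= mulr1 mulr0 subr0 => /eqP; rewrite oner_eq0.
Qed.

(** In a two-step nilpotent group the commutator of [l] and [l'] has logarithm
    [[l, l']]. *)
Lemma lattice_bracket l l' : L l -> L l' -> L (bracket l l').
Proof.
have [[_ LM LN] _ _] := lL; move=> Ll Ll'.
have -> : bracket l l' = - hmul (hmul l l') (- hmul l' l).
  rewrite {1}/hmul bracketNr.
  have -> : hmul l l' = hmul l' l - bracket l l'.
    rewrite /hmul (addrC l') (bracketC l l') scalerN opprK -[in RHS]addrA; congr (_ + _).
    rewrite -[X in _ = _ - X]scale1r -scalerBl -scaleNr; congr (_ *: _).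
    by field.
  rewrite bracketDl bracketxx bracketNl bracket_bracketl oppr0 addr0 oppr0.
  by rewrite scaler0 subr0 addrAC subrr add0r opprK.
by apply: (LN); apply: (LM); [exact: LM|apply: LN; exact: LM].
Qed.

Let pr (U : h) : 'rV[R]_(n + n) := row_mx U.1.1 U.1.2.

Let prM g k : pr (hmul g k) = pr g + pr k.
Proof. by rewrite /pr add_row_mx /= !scaler0 !subr0. Qed.

Let prZ a g : pr (a *: g) = a *: pr g.
Proof. by rewrite /pr scale_row_mx. Qed.

Let lattice_zmul (a : int) l : L l -> L (a%:~R *: l).
Proof.
have [[L0 LM LN] _ _] := lL; move=> Ll.
have Ln (m : nat) : L (m%:R *: l).
  elim: m => [|m IH]; first by rewrite scale0r.
  rewrite -natr1 scalerDl scale1r -[X in X + l](subr0 _).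
  have -> : m%:R *: l - 0 + l = hmul (m%:R *: l) (1 *: l).
    by rewrite hmul_scale scalerDl scale1r subr0.
  by rewrite scale1r; exact: LM.
case: a => m; first exact: Ln.
by rewrite NegzE mulrNz scaleNr; apply: LN; exact: Ln.
Qed.

Let lattice_zcomb m (l : 'I_m -> h) (a : 'I_m -> int) : (forall i, L (l i)) ->
  exists2 l', L l' & pr l' = \sum_i (a i)%:~R *: pr (l i).
Proof.
have [[L0 LM _] _ _] := lL; move=> Ll.
apply: (big_ind (fun v => exists2 l', L l' & pr l' = v)).
- by exists 0 => //; rewrite /pr row_mx0.
- by move=> _ _ [x Lx <-] [y Ly <-]; exists (hmul x y); [exact: LM|exact: prM].
- by move=> i _; exists ((a i)%:~R *: l i); [exact: lattice_zmul|exact: prZ].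
Qed.

(** If the projections of the elements of [L] span a proper subspace, some
    nonzero linear form vanishes on them, against [lattice_linear_form].  The rank is
    raised one element at a time. *)
Let lattice_spans : exists m (l : 'I_m -> h), (forall i, L (l i)) /\
  forall g, exists a : 'I_m -> R, pr g = \sum_i a i *: pr (l i).
Proof.
suff rk r : (r <= n + n)%N -> exists m (l : 'I_m -> h), (forall i, L (l i)) /\
    (r <= \rank (\matrix_(i < m) pr (l i)))%N.
  have [m [l [Ll fl]]] := rk _ (leqnn _); exists m, l; split=> // g.
  have /submxP[a ga] : (pr g <= \matrix_(i < m) pr (l i))%MS.
    by apply: submx_full; rewrite /row_full eqn_leq rank_leq_col.
  exists (fun i => a 0 i); rewrite ga mulmx_sum_row.
  by apply: eq_bigr => i _; rewrite rowK.
elim: r => [_|r IH rn]; first by exists 0%N, (fun _ => 0); split=> // -[].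
have [m [l [Ll rl]]] := IH (ltnW rn).
set A := \matrix_(i < m) pr (l i) in rl *.
have [rA|rA] := leqP r.+1 (\rank A); first by exists m, l.
have [l0 Ll0 l0A] : exists2 l0, L l0 & ~~ (pr l0 <= A)%MS.
  apply/not_exists2P => H.
  have cA j U : (pr U *m cokermx A) 0 j = 0.
    have [ell ellE] : exists ell : {linear h -> R},
        ell = (fun U => (pr U *m cokermx A) 0 j) :> (h -> R).
      apply: linear_packed => a V W.
      by rewrite /pr -add_row_mx -scale_row_mx mulmxDl -scalemxAl !mxE.
    suff : ell U = 0 by rewrite ellE.
    apply: lattice_linear_form => [V W|l' Ll']; rewrite ellE.
      by rewrite /pr row_mx0 mul0mx mxE.
    by have [//|/negP] := H l'; rewrite negbK submxE => /eqP ->; rewrite mxE.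
  have fA : row_full A.
    rewrite -sub1mx; apply/row_subP => i; rewrite submxE; apply/eqP/rowP => j.
    have -> : row i 1%:M = pr ((lsubmx (row i 1%:M), rsubmx (row i 1%:M)), 0).
      by rewrite /pr hsubmxK.
    by rewrite cA mxE.
  by move: rA; rewrite (eqP fA) ltnS leqNgt rn.
exists (1 + m)%N, (fun i => match fintype.split i with inl _ => l0 | inr j => l j end).
split=> [i|]; first by case: (fintype.split i).
rewrite (_ : \matrix_(i < _) _ = col_mx (pr l0) A); last first.
  apply/row_matrixP => i; rewrite rowK; case: fintype.splitP => j ij.
    have -> : i = lshift m j by exact: val_inj.
    by rewrite rowKu row_id.
  have -> : i = rshift 1 j by exact: val_inj.
  by rewrite rowKd rowK.
rewrite -addsmxE; apply: leq_ltn_trans rl _; apply: rank_ltmx.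
by rewrite /ltmx addsmxSr /= addsmx_sub negb_and l0A.
Qed.

(** Expand the projection of [g] to [H / Z] along elements of [L], and multiply by
    an element of [L] that subtracts the integer parts of the coefficients; then
    do the same in the center with the commutator of two elements of [L]. *)
Lemma lattice_cocompact : (0 < n)%N -> exists K : set h, compact K /\
  forall g, exists k l, [/\ K k, L l & hmul g l = k].
Proof.
move=> n0; have [m [l [Ll lS]]] := lattice_spans.
have [l1 [l2 [Ll1 Ll2 c0]]] := lattice_noncommuting n0.
have [[L0 LM LN] _ _] := lL.
set c := (bracket l1 l2).2 in c0.
have Lc : L ((0, 0), c) by exact: (lattice_bracket Ll1 Ll2).
(* Bounds each coordinate of a combination with coefficients in [0, 1]. *)
pose M : R := \sum_(i < m) \sum_j `|pr (l i) 0 j|.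
pose seg (b : R) : set R := [set` `[- b, b]].
pose box (v : 'rV[R]_n) := forall j, seg M (v 0 j).
exists [set U : h | (box U.1.1 /\ box U.1.2) /\ seg `|c| U.2]; split.
  have -> : [set U : h | (box U.1.1 /\ box U.1.2) /\ seg `|c| U.2] =
      ((box : set _) `*` (box : set _)) `*` seg `|c| by [].
  have cseg b : compact (seg b) by exact: segment_compact.
  have cbox : compact (box : set 'rV[R]_n).
    exact: (@rV_compact _ n (fun _ => seg M) (fun _ => cseg M)).
  exact: compact_setX (compact_setX cbox cbox) (cseg _).
move=> g; have [a ga] := lS g.
have [l' Ll' l'E] := lattice_zcomb (fun i => - Num.floor (a i)) Ll.
set g' := hmul g l'.
have g'j j : seg M (pr g' 0 j).
  have -> : pr g' = \sum_i (a i - (Num.floor (a i))%:~R) *: pr (l i).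
    rewrite /g' prM ga l'E -big_split /=; apply: eq_bigr => i _.
    by rewrite -scalerDl mulrNz.
  rewrite /seg /= in_itv /= -ler_norml summxE.
  apply: le_trans (ler_norm_sum _ _ _) _; apply: ler_sum => i _.
  rewrite mxE normrM (bigD1 j) //=; apply: ler_wpDr; first exact: sumr_ge0.
  rewrite ler_piMl // ger0_norm ?subr_ge0 ?floor_le //.
  by rewrite lerBlDl -[1]/(1%:~R) -intrD ltW // floorD1_gt.
(* The remaining correction is a power of the central element, which leaves
   the first coordinates unchanged. *)
pose z := - Num.floor (g'.2 / c).
exists (hmul g' (z%:~R *: ((0, 0), c))), (hmul l' (z%:~R *: ((0, 0), c))); split.
- have -> : hmul g' (z%:~R *: ((0, 0), c)) = g' + z%:~R *: ((0, 0), c).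
    by rewrite /hmul bracketZr bracketC bracket_Zl oppr0 !scaler0 subr0.
  split=> /=; first split=> j.
  + by rewrite scaler0 addr0; have := g'j (lshift n j); rewrite row_mxEl.
  + by rewrite scaler0 addr0; have := g'j (rshift n j); rewrite row_mxEr.
  + rewrite /seg /= in_itv /= -ler_norml.
    have -> : g'.2 + z%:~R * c = (g'.2 / c - (Num.floor (g'.2 / c))%:~R) * c.
      by rewrite mulrBl divfK // /z mulrNz mulNr.
    rewrite normrM ler_piMl // ger0_norm ?subr_ge0 ?floor_le //.
    by rewrite lerBlDl -[1]/(1%:~R) -intrD ltW // floorD1_gt.
- by apply: LM => //; exact: lattice_zmul.
- by rewrite hmulA.
Qed.

End LatticeCharacters.
End Cocompactness.

(** * Quotients by free and proper actions *)

Section SecondCountable.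
Context {R : realType}.

(** The boxes with rational coordinates form a countable basis. *)
Lemma finite_dim_second_countable (V : normedModType R) :
  finite_dim V -> @second_countable V.
Proof.
move=> [m [e [c [cc ce ec]]]].
pose box (q : {ffun 'I_m -> rat * rat}) : set V :=
  [set v | forall i, ratr (q i).1 < c i v < ratr (q i).2].
exists (range box).
  by apply: card_le_trans (card_image_le _ _) _; exact: countableP.
split=> [_ [q _ <-]|x A xA].
  rewrite openE => v bv; apply: filter_forall => i.
  have nV : \forall a \near c i v, a \in `]ratr (q i).1, ratr (q i).2[.
    have bi : c i v \in `]ratr (q i).1, ratr (q i).2[.
      by rewrite in_itv; exact: bv.
    exact: near_in_itvoo bi.
  have : \forall w \near v, c i w \in `]ratr (q i).1, ratr (q i).2[.
    exact: cc nV.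
  by apply: filterS => w; rewrite in_itv.
have [F FE] : exists F : {linear 'rV[R]_m -> V},
    F = (fun u => \sum_i u 0 i *: e i) :> ('rV[R]_m -> V).
  apply: linear_packed => a u w; rewrite scaler_sumr -big_split /=.
  by apply: eq_bigr => i _; rewrite !mxE scalerDl scalerA.
have FK v : F (\row_i c i v) = v.
  by rewrite FE [RHS]ec; apply: eq_bigr => i _; rewrite mxE.
have cF : continuous F by exact/finite_dim_continuous/finite_dim_row.
have : nbhs (\row_i c i x : 'rV[R]_m) (F @^-1` A) by apply: cF; rewrite FK.
move=> /nbhs_ballP[eps /= eps0 sub].
have qP i : exists p : rat * rat,
    c i x - eps < ratr p.1 < c i x /\ c i x < ratr p.2 < c i x + eps.
  have [|p /itvP pP] := @rat_in_itvoo R (c i x - eps) (c i x).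
    by rewrite ltrBlDr ltrDl.
  have [|p' /itvP p'P] := @rat_in_itvoo R (c i x) (c i x + eps).
    by rewrite ltrDl.
  by exists (p, p'); rewrite /= !pP !p'P.
have [q qE] := choice qP.
exists (box (finfun q)).
  split; first by exists (finfun q).
  by move=> i; rewrite ffunE; have [/andP[_ ->] /andP[-> _]] := qE i.
move=> v bv; rewrite -(FK v); apply: sub; split=> // i j; rewrite !mxE.
have [/andP[l1 _] /andP[_ l2]] := qE j.
have := bv j; rewrite ffunE => /andP[b1 b2].
rewrite /ball /= ltr_distlC; apply/andP; split.
  exact: lt_trans l1 b1.
exact: lt_trans b2 l2.
Qed.

End SecondCountable.

Lemma open_preimage_on (S S' : topologicalType) (A : set S) (B : set S') (f : S -> S') :
  open A -> open B -> (forall x, A x -> {for x, continuous f}) ->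
  open (A `&` f @^-1` B).
Proof.
move=> oA oB cf; rewrite openE => x [Ax Bx].
apply: filterI; first exact: open_nbhs_nbhs.
by apply: cf => //; exact: open_nbhs_nbhs.
Qed.

Section ProperAction.
Context {R : realType} {T : normedModType R} {C : Type}.
Context (G : set C) (act : T -> C -> T) (orb : T -> set T).
Hypothesis orbP : forall x y, orb x = orb y <-> exists2 c, G c & act x c = y.
Hypothesis smooth_act : forall c, G c -> smooth_on setT (fun x => act x c).
Hypothesis proper_act : forall x y, \forall z \near (x, y),
  forall c, G c -> act z.1 c = z.2 -> act x c = y.
Hypothesis free_act : forall c x, G c -> act x c = x -> forall y, act y c = y.
Hypothesis fT : finite_dim T.

Local Notation M := (orbit_space orb).
Local Notation proj := (orbit_proj orb).

Lemma projP x y : proj x = proj y <-> exists2 c, G c & act x c = y.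
Proof. by rewrite orbit_proj_eq; exact: orbP. Qed.

Lemma continuous_act c : G c -> continuous (fun x => act x c).
Proof. by move=> Gc x; exact: (smooth_act Gc 0). Qed.

Lemma proj_act c x : G c -> proj (act x c) = proj x.
Proof. by move=> Gc; apply/esym/projP; exists c. Qed.

(** The saturation of an open set is a union of its preimages under the maps
    [act^~ c]. *)
Lemma open_proj (U : set T) : open U -> open (proj @` U).
Proof.
move=> oU; apply/open_orbit_space.
have -> : proj @^-1` (proj @` U) = \bigcup_(c in G) ((fun x => act x c) @^-1` U).
  apply/seteqP; split=> x /=.
    by move=> [u Uu /esym/projP[c Gc xcu]]; exists c => //=; rewrite xcu.
  by move=> [c Gc /= Uxc]; exists (act x c) => //; exact: proj_act.
apply: bigcup_open => c Gc; apply: open_comp => // x _.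
exact: continuous_act.
Qed.

Lemma orbit_space_hausdorff : hausdorff_space M.
Proof.
rewrite open_hausdorff => p q; have [x <-] := orbit_proj_surj p.
have [y <-] := orbit_proj_surj q => /eqP xy.
have [[A B] [/= xA yB] AB] := proper_act x y.
move: xA yB; rewrite !nbhsE => -[U [oU Ux] UA] [V [oV Vy] VB].
exists (proj @` U, proj @` V) => /=.
  by split; apply/mem_set; [exists x|exists y].
split; [exact: open_proj|exact: open_proj|apply/eqP].
apply/seteqP; split=> // r [[u Uu <-] [v Vv /esym/projP[c Gc ucv]]].
apply: xy; apply/projP; exists c => //.
by apply: (AB (u, v)) => //; split; [exact: UA|exact: VB].
Qed.

Lemma orbit_space_second_countable : @second_countable M.
Proof.
have [B cB [oB bB]] := finite_dim_second_countable fT.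
exists [set proj @` U | U in B].
  exact: card_le_trans (card_image_le _ _) cB.
split=> [_ [U BU <-]|p A pA]; first by apply: open_proj; exact: oB.
have [x px] := orbit_proj_surj p.
have : nbhs x (proj @^-1` A) by apply: orbit_proj_continuous; rewrite px.
move=> /bB[U [BU Ux] UA].
exists (proj @` U); first by split; [exists U|exists x].
by move=> _ [u Uu <-]; exact: UA.
Qed.

Definition slice (U : set T) : Prop := open U /\ {in U &, injective proj}.

Definition slice_section (U : set T) (q : M) : T :=
  xget 0 [set u | U u /\ proj u = q].

Definition slice_chart (U : set T) : chart T M :=
  Chart (proj @` U) U (slice_section U) proj.

(** Properness at [(x, x)] provides an open set in which two points of one orbit
    are related by some [c] that fixes [x]; such a [c] acts trivially. *)
Lemma slice_exists x : exists2 U, slice U & U x.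
Proof.
have [[A B] [/= xA xB] AB] := proper_act x x.
move: xA xB; rewrite !nbhsE => -[U [oU Ux] UA] [V [oV Vx] VB].
exists (U `&` V); last by [].
split; first exact: openI.
move=> u v /set_mem[Uu Vu] /set_mem[Uv Vv] /projP[c Gc ucv].
have /(free_act Gc) xc : act x c = x.
  by apply: (AB (u, v)) => //; split; [exact: UA|exact: VB].
by rewrite -ucv xc.
Qed.

Lemma slice_sectionK U u : slice U -> U u -> slice_section U (proj u) = u.
Proof.
move=> [_ iU] Uu; apply: xget_unique => // v [Uv vu].
by apply: iU => //; exact/mem_set.
Qed.

Lemma slice_is_chart U : slice U -> is_chart (slice_chart U).
Proof.
move=> sU; have [oU _] := sU.
split=> /=.
- by split=> //; exact: open_proj.
- by move=> _ [u Uu <-]; rewrite (slice_sectionK sU Uu).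
- by move=> y Uy; split; [exists y|exact: (slice_sectionK sU Uy)].
- move=> _ [u Uu <-] A /=; rewrite (slice_sectionK sU Uu) => uA.
  have : nbhs u (A `&` U) by apply: filterI => //; exact: open_nbhs_nbhs.
  rewrite nbhsE => -[V [oV Vu] VA].
  have : nbhs (proj u) (proj @` V).
    by apply: open_nbhs_nbhs; split; [exact: open_proj|exists u].
  apply: filterS => _ [v Vv <-]; have [Av Uv] := VA v Vv.
  by rewrite /= (slice_sectionK sU Uv).
- by move=> y _; exact: orbit_proj_continuous.
Qed.

Definition slice_atlas : set (chart T M) := [set slice_chart U | U in slice].

(** Two sections through points of the same orbit differ, near these points, by
    the action of one fixed [c], so that the transition maps are locally given
    by smooth maps of the action. *)
Lemma slice_atlas_manifold : smooth_manifold slice_atlas.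
Proof.
split; [exact: orbit_space_hausdorff|exact: orbit_space_second_countable|split].
- by move=> _ [U sU <-]; exact: slice_is_chart.
- move=> p; have [x <-] := orbit_proj_surj p; have [U sU Ux] := slice_exists x.
  by exists (slice_chart U); [exists U|exists x].
- move=> _ _ [U sU <-] [V sV <-] k; apply: Ck_on_local => y [/= Uy [v Vv vy]].
  have /projP[c Gc ycv] : proj y = proj v by [].
  exists ((fun x => act x c) @^-1` V), (fun x => act x c); split.
  + by have [oV _] := sV; apply: open_comp => // x _; exact: continuous_act.
  + by rewrite /= ycv.
  + move=> x Vxc; rewrite /transition /=.
    by rewrite -[LHS](slice_sectionK sV Vxc) proj_act.
  + by apply: Ck_on_sub (smooth_act Gc k).
Qed.

Lemma smooth_on_id U : smooth_on U (fun x : T => x).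
Proof. by move=> k; apply: (@Ck_on_linear _ _ _ _ _ idfun) => x. Qed.

Lemma slice_atlas_local_diffeo : local_diffeo slice_atlas proj.
Proof.
move=> x; have [U sU Ux] := slice_exists x; have [oU _] := sU.
exists (slice_chart U), U, U; split=> //.
- by exists U.
- by move=> z Uz; exists z.
- split=> //.
    move=> k; apply: Ck_on_eq (smooth_on_id U k) => // y Uy.
    by rewrite /= (slice_sectionK sU Uy).
  exists id; split; first exact: smooth_on_id.
    by move=> y Uy /=; rewrite (slice_sectionK sU Uy).
  by move=> y Uy /=; rewrite (slice_sectionK sU Uy).
Qed.

End ProperAction.

(** * Descent of an invariant metric *)

Section LocalDiffeomorphisms.
Context {R : realType} {V W : normedModType R} (U : set V) (U' : set W).
Context (f : V -> W) (s : W -> V).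
Hypothesis oU : open U.
Hypothesis sf : smooth_on U f.
Hypothesis ss : smooth_on U' s.
Hypothesis fU : forall x, U x -> U' (f x) /\ s (f x) = x.

Lemma diff_inverseK x v : U x -> 'd s (f x) ('d f x v) = v.
Proof.
move=> Ux; have [df _] := sf 1%N; have [ds _] := ss 1%N.
rewrite -diff_compE; [|exact: df|by apply: ds; have [] := fU Ux].
have n : \forall y \near x, y = s (f y).
  apply: filterS (open_nbhs_nbhs (conj oU Ux)) => y Uy.
  by have [_ ->] := fU Uy.
have ci : continuous (idfun : V -> V) by move=> y; exact: cvg_id.
have di : differentiable (idfun : V -> V) x by exact: linear_differentiable.
have [_ ->] := diff_near_eq n di.
exact: (@diff_linE _ _ _ idfun).
Qed.

End LocalDiffeomorphisms.

Section MetricDescent.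
Context {R : realType} {T : normedModType R} {C : Type}.
Context (G : set C) (act : T -> C -> T) (orb : T -> set T).
Hypothesis orbP : forall x y, orb x = orb y <-> exists2 c, G c & act x c = y.
Hypothesis smooth_act : forall c, G c -> smooth_on setT (fun x => act x c).
Hypothesis fT : finite_dim T.

Local Notation M := (orbit_space orb).
Local Notation proj := (orbit_proj orb).

Context (A : set (chart T M)).
Hypothesis mA : smooth_manifold A.
Hypothesis dA : local_diffeo A proj.

Local Notation chart_proj c := (fun x : T => chart_fun c (proj x)).

Lemma overlap_open c d : A c -> A d -> open (overlap c d).
Proof.
have [_ _ [cA _ _]] := mA.
move=> /cA[[_ oc] _ _ _ ci] /cA[[od _] _ _ _ _].
exact: open_preimage_on.
Qed.

(** The hypothesis on the projection only speaks of one chart around each point;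
    composing with the smooth changes of charts extends it to all charts. *)
Lemma chart_proj_diffeo c x : A c -> chart_dom c (proj x) ->
  exists (U U' : set T), [/\ U x, U `<=` proj @^-1` chart_dom c &
    diffeo_on U U' (chart_proj c)].
Proof.
move=> Ac cx; have [_ _ [cA _ tA]] := mA.
have [d [U0 [U0' [Ad U0x U0d [oU0 oU0' sf [s [ss sK fK]]]]]]] := dA x.
have [[odc occ] ck ck' cc ci] := cA _ Ac.
have [[odd ocd] dk dk' _ di] := cA _ Ad.
have oU : open (U0 `&` proj @^-1` chart_dom c).
  by apply: open_preimage_on => // y _; exact: orbit_proj_continuous.
have oU' : open (overlap c d `&` transition c d @^-1` U0').
  apply: open_preimage_on => //; first exact: overlap_open.
  exact: (tA c d Ac Ad 0%N).
exists (U0 `&` proj @^-1` chart_dom c), (overlap c d `&` transition c d @^-1` U0').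
split; [by []|by move=> y []|split; [exact: oU|exact: oU'| |]].
  move=> k; apply: (@Ck_on_eq _ _ _ _ _
      (fun y => transition d c ((chart_fun d \o proj) y))) => //.
    by move=> y [U0y cy]; rewrite /transition /= (dk _ (U0d _ U0y)).2.
  apply: (Ck_on_comp fT oU (overlap_open Ad Ac)).
  - move=> y [U0y cy]; have [dy dyK] := dk _ (U0d _ U0y).
    by split=> //=; rewrite dyK.
  - by apply: Ck_on_sub (sf k) => y [].
  - exact: tA.
exists (fun y => s (transition c d y)); split.
- move=> k; apply: (Ck_on_comp fT oU' oU0').
  + by move=> y [].
  + by apply: Ck_on_sub (tA c d Ac Ad k) => y [].
  + exact: ss.
- move=> y [U0y cy]; have [cy' cyK] := ck _ cy.
  have [fy sy] := sK _ U0y.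
  have tE : transition c d (chart_fun c (proj y)) = chart_fun d (proj y).
    by rewrite /transition /= cyK.
  rewrite tE; split=> //; split; last by rewrite /= tE.
  by split=> //=; rewrite cyK; exact: U0d.
- move=> y [[cy dy] /= U0y]; have [Us fs] := fK _ U0y.
  have ps : proj (s (transition c d y)) = chart_inv c y.
    have [_ <-] := dk _ (U0d _ Us).
    by move: fs => /= ->; rewrite /transition /= (dk _ dy).2.
  rewrite ps; have [cy' cyK] := ck' _ cy; rewrite cyK; split=> //; split=> //=.
Qed.

Lemma chart_proj_differentiable c x : A c -> chart_dom c (proj x) ->
  differentiable (chart_proj c) x.
Proof.
move=> Ac /(chart_proj_diffeo Ac)[U [U' [Ux _ [_ _ sf _]]]].
by have [df _] := sf 1%N; exact: df.
Qed.

Lemma chart_proj_diff_bij c x : A c -> chart_dom c (proj x) ->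
  exists2 e : {linear T -> T}, cancel ('d (chart_proj c) x) e &
    cancel e ('d (chart_proj c) x).
Proof.
move=> Ac /(chart_proj_diffeo Ac)[U [U' [Ux _ [oU oU' sf [s [ss sK fK]]]]]].
exists ('d s (chart_fun c (proj x))).
  by move=> v; exact: (diff_inverseK oU sf ss sK).
move=> v; have [Ux' sx] := sK x Ux.
by have := @diff_inverseK _ _ _ _ _ _ _ oU' ss sf fK _ v Ux'; rewrite sx.
Qed.

Context (g : T -> T -> T -> R).
Hypothesis lg : lorentz_metric_on setT g.
Hypothesis ig : forall c, G c -> forall x u v,
  g (act x c) ('d (fun x => act x c) x u) ('d (fun x => act x c) x v) = g x u v.

(** The point and the vectors are chosen among preimages; by [descended_metricE]
    the choice is immaterial for an invariant [g]. *)
Definition descended_metric (c : chart T M) (y u v : T) : R :=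
  let x := xget 0 [set x | proj x = chart_inv c y] in
  g x (xget 0 [set w | 'd (chart_proj c) x w = u])
      (xget 0 [set w | 'd (chart_proj c) x w = v]).

(** The preimage chosen in [descended_metric] differs from [x] by an element of
    [G], which preserves both [g] and the map to the chart; so [g] takes the same
    value there. *)
Lemma descended_metricE c x u v : A c -> chart_dom c (proj x) ->
  descended_metric c (chart_fun c (proj x))
    ('d (chart_proj c) x u) ('d (chart_proj c) x v) = g x u v.
Proof.
move=> Ac cx; have [_ _ [cA _ _]] := mA.
have [_ ck _ _ _] := cA _ Ac; have [_ ckx] := ck _ cx.
rewrite /descended_metric ckx.
set x' := xget 0 [set x' | proj x' = proj x].
have x'x : proj x' = proj x by apply: (@xgetI _ 0 [set x' | proj x' = proj x] x).
have [k Gk xk] : exists2 k, G k & act x k = x'.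
  by apply/orbP/orbit_proj_eq.
have dk : differentiable (fun y => act y k) x.
  by have [dk _] := smooth_act Gk 1%N; exact: dk.
have cx' : chart_dom c (proj x') by rewrite x'x.
have dE w : 'd (chart_proj c) x' ('d (fun y => act y k) x w) = 'd (chart_proj c) x w.
  rewrite -xk -(@diff_compE _ _ _ _ (fun y => act y k) (chart_proj c)) //.
    congr ('d _ x w); apply/funext => y; congr (chart_fun c _).
    by apply/esym/orbit_proj_eq/orbP; exists k.
  by rewrite xk; exact: chart_proj_differentiable.
have [e eK _] := chart_proj_diff_bij Ac cx'.
have xE w : xget 0 [set w' | 'd (chart_proj c) x' w' = 'd (chart_proj c) x w] =
    'd (fun y => act y k) x w.
  apply: xget_unique => [|w' w'w]; first exact: dE.
  by apply: (can_inj eK); rewrite dE.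
by rewrite !xE -xk; exact: ig.
Qed.

Lemma descended_is_pullback : is_pullback A proj descended_metric g.
Proof. by move=> c Ac x cx u v; rewrite -(descended_metricE _ _ Ac cx). Qed.

Lemma lorentz_form_linear_iso (b : T -> T -> R) (l l' : {linear T -> T}) :
  cancel l l' -> cancel l' l -> lorentz_form b ->
  lorentz_form (fun u v => b (l u) (l v)).
Proof.
move=> lK l'K [bl bs [u0 bu0 bpos]]; split.
- by move=> a u v w; rewrite linearP bl.
- by move=> u v; exact: bs.
- exists (l' u0); first by rewrite l'K.
  move=> v; rewrite l'K => /bpos H v0; apply: H.
  by apply: contraNneq v0 => lv; rewrite -(lK v) lv linear0.
Qed.

(** Near [chart_fun c (proj x)] the metric is that of [g] transported by a smooth
    local inverse of the map to the chart, the preimages of all nearby points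
    being taken in one neighbourhood of [x]. *)
Lemma descended_lorentz : lorentz_metric A descended_metric.
Proof.
have [_ _ [cA _ tA]] := mA; have [lx gs] := lg.
split=> [c Ac|c d Ac Ad y [cy dy] u v].
  have [[odc occ] ck ck' cc ci] := cA _ Ac.
  have loc y : chart_cod c y -> exists x, chart_dom c (proj x) /\ chart_fun c (proj x) = y.
    move=> /ck'[cy yK]; have [x xE] := orbit_proj_surj (chart_inv c y).
    by exists x; rewrite xE.
  split=> [y /loc[x [cx <-]]|u v k].
    have [e eK eK'] := chart_proj_diff_bij Ac cx.
    have -> : descended_metric c (chart_fun c (proj x)) = fun u v => g x (e u) (e v).
      apply/funext => u; apply/funext => v.
      by rewrite -(descended_metricE _ _ Ac cx) !eK'.
    exact: (lorentz_form_linear_iso eK' eK (lx x I)).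
  apply: Ck_on_local => y /loc[x [cx <-]].
  have [U [U' [Ux Uc [oU oU' sf [s [ss sK fK]]]]]] := chart_proj_diffeo Ac cx.
  exists U', (fun y => g (s y) ('d s y u) ('d s y v)); split=> //.
  - by have [] := sK _ Ux.
  - move=> z U'z; have [Us fs] := fK _ U'z.
    rewrite -(descended_metricE _ _ Ac (Uc _ Us)).
    have E w : 'd (chart_proj c) (s z) ('d s z w) = w.
      exact: (@diff_inverseK _ _ _ _ _ _ _ oU' ss sf fK).
    by rewrite !E fs.
  - have [gl gr] : (forall x (a : R) u v w, g x (a *: u + v) w = a * g x u w + g x v w) /\
        (forall x (a : R) u v w, g x w (a *: u + v) = a * g x w u + g x w v).
      split=> z a w w' w''; have [bl bs _] := lx z I; first exact: bl.
      by rewrite bs bl !(bs _ w'').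
    have [_ Cs] := ss k.+1.
    apply: (@Ck_on_family _ _ _ _ _ _ (fun y w => g (s y) ('d s y u) w)) => //.
    move=> w; apply: (@Ck_on_family _ _ _ _ _ _ (fun y w' => g (s y) w' w)) => //.
    move=> w'; apply: (@Ck_on_comp _ _ _ _ _ U' setT s (fun x => g x w' w)) => //.
    + exact: openT.
    + exact: gs.
    + exact: Cs.
    + exact: Cs.
have [[odc occ] ck ck' cc ci] := cA _ Ac.
have [cy' yK] := ck' _ cy; have [x xE] := orbit_proj_surj (chart_inv c y).
have cx : chart_dom c (proj x) by rewrite xE.
have dx : chart_dom d (proj x) by rewrite xE.
have yE : y = chart_fun c (proj x) by rewrite xE.
have tE : transition c d y = chart_fun d (proj x) by rewrite /transition /= xE.
have [e eK eK'] := chart_proj_diff_bij Ac cx.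
have dtE w : 'd (transition c d) y ('d (chart_proj c) x w) = 'd (chart_proj d) x w.
  rewrite yE -(@diff_compE _ _ _ _ (chart_proj c) (transition c d)).
  - have [U [U' [Ux Uc [oU _ _ _]]]] := chart_proj_diffeo Ac cx.
    have n : \forall z \near x, transition c d (chart_fun c (proj z)) =
        chart_fun d (proj z).
      apply: filterS (open_nbhs_nbhs (conj oU Ux)) => z Uz.
      by rewrite /transition /= (ck _ (Uc _ Uz)).2.
    have nn : \forall z \near x, chart_fun d (proj z) =
        transition c d (chart_fun c (proj z)) by apply: filterS n => z ->.
    by have [_ ->] := diff_near_eq nn (chart_proj_differentiable Ad dx).
  - exact: chart_proj_differentiable.
  - have [dt _] := tA c d Ac Ad 1%N; apply: dt.
    by rewrite -yE.
rewrite tE -[u](eK' u) -[v](eK' v) !dtE descended_metricE // yE.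
by rewrite descended_metricE.
Qed.

End MetricDescent.

(** * Splittings and infinitesimally definite derivations *)

Section AffineMaps.
Context {R : realType} {V W : normedModType R} (l : {linear V -> W}) (a : W).
Hypothesis cl : continuous l.

Lemma diff_affineE x v : 'd (fun y => a + l y) x v = l v.
Proof.
have dl : differentiable l x by exact: linear_differentiable.
have -> : (fun y => a + l y) = cst a + l by [].
have -> : 'd (cst a + l) x = 'd (cst a) x \+ 'd l x :> (V -> W).
  by apply: diffD => //; exact: differentiable_cst.
have -> : 'd (cst a) x = 0 :> (V -> W) by exact: diff_cst.
by rewrite /= add0r diff_linE.
Qed.

Lemma smooth_on_affine (U : set V) : open U -> smooth_on U (fun y => a + l y).
Proof. by move=> oU k; apply: Ck_onD => //; [exact: Ck_on_cst|exact: Ck_on_linear]. Qed.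

Lemma differentiable_affine x : differentiable (fun y => a + l y) x.
Proof. by have [d _] := smooth_on_affine (@openT V) 1%N; exact: d. Qed.

End AffineMaps.

Lemma diff_translateE (R : realType) (V W : normedModType R) (f : V -> W)
    (a x v : V) : differentiable f (a + x) ->
  'd (fun y => f (a + y)) x v = 'd f (a + x) v.
Proof.
move=> df; pose i : {linear V -> V} := idfun.
have ci : continuous i by move=> y; exact: cvg_id.
have da : differentiable (fun y => a + i y) x by exact: differentiable_affine.
have := @diff_compE _ _ _ _ (fun y => a + i y) f x v da df.
by rewrite diff_affineE.
Qed.

Section Splitting.
Context {R : realType} {n : nat}.
Local Notation h := (heis R n).
Context (p : set h) (Z0 : h).
Hypothesis Z0c : hcenter Z0.
Hypothesis Z0n : Z0 != 0.
Hypothesis sp : splitting p Z0.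

Definition zcoord (V : h) : R := xget 0 [set c | p (V - c *: Z0)].
Definition pproj (V : h) : h := V - zcoord V *: Z0.

Lemma split_p0 : p 0. Proof. by case: sp. Qed.
Lemma split_pP (a : R) U V : p U -> p V -> p (a *: U + V).
Proof. by case: sp => _ H _ _; exact: H. Qed.
Lemma split_pZ (a : R) U : p U -> p (a *: U).
Proof. by move=> pU; rewrite -[_ *: _]addr0; apply: split_pP => //; exact: split_p0. Qed.
Lemma split_pB U V : p U -> p V -> p (U - V).
Proof. by move=> pU pV; rewrite addrC -scaleN1r; exact: split_pP. Qed.

Lemma split_Z0 (c : R) : p (c *: Z0) -> c = 0.
Proof.
case: sp => _ _ _ H /H /eqP; rewrite scaler_eq0 (negbTE Z0n) orbF.
by move=> /eqP.
Qed.

Lemma pproj_p V : p (pproj V).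
Proof. by case: sp => _ _ /(_ V) pV _; exact: (xgetPex 0 pV). Qed.

Lemma zcoord_eq V c : p (V - c *: Z0) -> zcoord V = c.
Proof.
move=> pc; apply/eqP; rewrite eq_sym -subr_eq0; apply/eqP/split_Z0.
have := split_pB (pproj_p V) pc; rewrite /pproj opprB addrC addrA subrK.
by rewrite -scalerBl.
Qed.

Lemma zcoord_linear (a : R) U V : zcoord (a *: U + V) = a * zcoord U + zcoord V.
Proof.
apply: zcoord_eq; rewrite scalerDl -scalerA opprD addrACA -scalerBr.
exact: split_pP (pproj_p U) (pproj_p V).
Qed.

Lemma zcoord_p V : p V -> zcoord V = 0.
Proof. by move=> pV; apply: zcoord_eq; rewrite scale0r subr0. Qed.

Lemma zcoord_Z0 : zcoord Z0 = 1.
Proof. by apply: zcoord_eq; rewrite scale1r subrr; exact: split_p0. Qed.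

Lemma zcoord0 : zcoord 0 = 0.
Proof. exact/zcoord_p/split_p0. Qed.

Lemma pproj_linear (a : R) U V : pproj (a *: U + V) = a *: pproj U + pproj V.
Proof. by rewrite /pproj zcoord_linear scalerDl -scalerA opprD addrACA -scalerBr. Qed.

Lemma pproj_id V : p V -> pproj V = V.
Proof. by move=> pV; rewrite /pproj zcoord_p // scale0r subr0. Qed.

Lemma pproj_Z0 : pproj Z0 = 0.
Proof. by rewrite /pproj zcoord_Z0 scale1r subrr. Qed.

Lemma pprojK V : pproj V + zcoord V *: Z0 = V.
Proof. by rewrite /pproj subrK. Qed.

Lemma omega0_linearl (a : R) U V W :
  omega0 Z0 (a *: U + V) W = a * omega0 Z0 U W + omega0 Z0 V W.
Proof. by rewrite /omega0 bracket_linearl /= mulrDl mulrA. Qed.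

Lemma omega0_linearr (a : R) U V W :
  omega0 Z0 W (a *: U + V) = a * omega0 Z0 W U + omega0 Z0 W V.
Proof. by rewrite /omega0 bracket_linearr /= mulrDl mulrA. Qed.

Lemma omega0C U V : omega0 Z0 V U = - omega0 Z0 U V.
Proof. by rewrite /omega0 bracketC -mulNr. Qed.

Lemma omega00r U : omega0 Z0 U 0 = 0.
Proof. by rewrite /omega0 bracket0r mul0r. Qed.

Lemma omega00l U : omega0 Z0 0 U = 0.
Proof. by rewrite /omega0 bracket0l mul0r. Qed.

(** Apply [d] to [[U, V] = omega0 (U, V) Z0] and use [d Z0 = 0]. *)
Lemma derivation_skew (d : h -> h) U V : derivation d -> d Z0 = 0 ->
  omega0 Z0 (d U) V = - omega0 Z0 U (d V).
Proof.
move=> [dl dB] dZ; apply/eqP; rewrite -addr_eq0 /omega0 -mulrDl.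
have [l lE] := linear_packed dl.
have : d (bracket U V) = 0.
  by rewrite (bracket_omega0 U V Z0c Z0n) -lE linearZ /= lE dZ scaler0.
by rewrite dB => /(congr1 snd) /= ->; rewrite mul0r.
Qed.

Section Extension.
Context (d : h -> h).
Hypothesis dM : Mp p Z0 d.

(** A derivation in [Mp] kills [Z0].  Extending its restriction to [p] by the
    identity on [Z0] gives a linear automorphism of the whole algebra, to which
    the results on inverses of smooth families apply. *)
Definition split_ext (V : h) : h := d (pproj V) + zcoord V *: Z0.

Lemma Mp_linear (a : R) U V : d (a *: U + V) = a *: d U + d V.
Proof. by case: dM => -[dl _] _ _ _. Qed.

Lemma split_ext_linear (a : R) U V :
  split_ext (a *: U + V) = a *: split_ext U + split_ext V.
Proof.
rewrite /split_ext pproj_linear zcoord_linear Mp_linear scalerDl -scalerA.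
by rewrite scalerDr addrACA.
Qed.

Lemma Mp_inj_p U : p U -> d U = 0 -> U = 0.
Proof.
move=> pU dU; apply/eqP; apply: contraT => U0.
by case: dM => _ _ _ /(_ U pU U0); rewrite dU omega00r ltxx.
Qed.

Lemma split_ext_ker V : split_ext V = 0 -> V = 0.
Proof.
case: dM => _ dp _ _; rewrite /split_ext => /eqP; rewrite addrC addr_eq0 => /eqP zE.
have z0 : zcoord V = 0.
  apply: split_Z0; rewrite zE -scaleN1r; apply: split_pZ; apply: dp; exact: pproj_p.
move/eqP: zE; rewrite z0 scale0r eq_sym oppr_eq0 => /eqP /(Mp_inj_p (pproj_p V)).
by move=> V0; rewrite -(pprojK V) V0 z0 scale0r addr0.
Qed.

Lemma split_ext_inj : injective split_ext.
Proof.
have [l lE] := linear_packed split_ext_linear.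
move=> U V; rewrite -lE => /eqP; rewrite -subr_eq0 -linearB lE => /eqP.
by move/split_ext_ker/eqP; rewrite subr_eq0 => /eqP.
Qed.

Definition split_ext_inv (V : h) : h := xget 0 [set U | split_ext U = V].

Lemma split_ext_invK V : split_ext (split_ext_inv V) = V.
Proof.
have [l lE] := linear_packed split_ext_linear.
have [|W lW] := @linear_inj_surj _ _ l V finite_dim_heis.
  by rewrite lE; exact: split_ext_inj.
have : exists U, [set U | split_ext U = V] U by exists W; rewrite /= -lE.
exact: xgetPex.
Qed.

Lemma split_extK : cancel split_ext split_ext_inv.
Proof. by move=> V; apply: split_ext_inj; rewrite split_ext_invK. Qed.

Lemma split_ext_inv_p X : p X -> p (split_ext_inv X) /\ d (split_ext_inv X) = X.
Proof.
move=> pX; case: dM => _ dp _ _.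
have E := split_ext_invK X; rewrite /split_ext in E.
have z0 : zcoord (split_ext_inv X) = 0.
  have pd := dp _ (pproj_p (split_ext_inv X)).
  apply: split_Z0; rewrite -[_ *: _](addKr (d (pproj (split_ext_inv X)))) E addrC.
  exact: split_pB.
have pE : pproj (split_ext_inv X) = split_ext_inv X.
  by rewrite /pproj z0 scale0r subr0.
split; first by rewrite -pE; exact: pproj_p.
by rewrite -[RHS]E z0 scale0r addr0 pE.
Qed.

(** On [p], the inverse of the extension is the inverse of [nu]; surjectivity of
    [nu] is what dimension counting provides through [split_ext_invK]. *)
Lemma pinv_split_ext X : p X -> 'pinv_(fun=> 0) p d X = split_ext_inv X.
Proof.
move=> pX; have [pU dU] := split_ext_inv_p pX; rewrite -[in LHS]dU.
apply: pinvKV; last exact/mem_set.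
move=> U V /set_mem pU' /set_mem pV UV; apply/eqP; rewrite -subr_eq0; apply/eqP.
apply: Mp_inj_p; first exact: split_pB.
by have [l lE] := linear_packed Mp_linear; rewrite -lE linearB lE UV subrr.
Qed.

Lemma split_ext_inv_linear (a : R) U V :
  split_ext_inv (a *: U + V) = a *: split_ext_inv U + split_ext_inv V.
Proof.
by apply: split_ext_inj; rewrite split_ext_linear !split_ext_invK.
Qed.

(** Write [X = nu U] and [Y = nu V]: both sides are values of [omega0] at [U], [nu V],
    equal by skewness of [nu]. *)
Lemma split_ext_inv_sym X Y : p X -> p Y ->
  omega0 Z0 (split_ext_inv X) Y = omega0 Z0 (split_ext_inv Y) X.
Proof.
move=> pX pY; have [_ dX] := split_ext_inv_p pX; have [_ dY] := split_ext_inv_p pY.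
case: dM => dd _ dZ _.
rewrite -[in LHS]dY omega0C (derivation_skew _ _ dd dZ) opprK.
by rewrite dX.
Qed.

Lemma split_ext_inv_pos X : p X -> X != 0 -> 0 < omega0 Z0 (split_ext_inv X) X.
Proof.
move=> pX X0; have [pU dU] := split_ext_inv_p pX; case: dM => _ _ _ pos.
rewrite -[X in omega0 _ _ X]dU; apply: pos => //.
apply: contraNneq X0 => U0; rewrite -dU U0.
by have [l lE] := linear_packed Mp_linear; rewrite -lE linear0.
Qed.

End Extension.
End Splitting.

(** * Paths of automorphisms and the associated metric *)

Section AutomorphismPaths.
Context {R : realType} {n : nat}.
Local Notation h := (heis R n).
Context (Phi : R -> h -> h).
Hypothesis aP : aut_path Phi.

Lemma path_aut t : lie_aut (Phi t). Proof. by case: aP. Qed.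

Lemma path_linear t (a : R) U V : Phi t (a *: U + V) = a *: Phi t U + Phi t V.
Proof. exact: lie_aut_linear (path_aut t) a U V. Qed.

Lemma dPhiE t : dPhi Phi t = Phi t.
Proof. exact: lie_aut_diff (path_aut t). Qed.

Lemma dPhi_invK t : cancel (Phi t) (dPhi_inv Phi t).
Proof.
move=> X; rewrite /dPhi_inv dPhiE; apply: pinvKV; last exact/mem_set.
by move=> U V _ _; exact: lie_aut_inj (path_aut t) U V.
Qed.

Lemma path_surj t X : exists U, Phi t U = X.
Proof.
have [_ [_ _ _ [f [_ _ fK]]]] := path_aut t.
by exists (f X); have [] := fK X I.
Qed.

Lemma dPhi_invKV t : cancel (dPhi_inv Phi t) (Phi t).
Proof. by move=> X; have [U <-] := path_surj t X; rewrite dPhi_invK. Qed.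

Lemma dPhi_inv_linear t (a : R) U V :
  dPhi_inv Phi t (a *: U + V) = a *: dPhi_inv Phi t U + dPhi_inv Phi t V.
Proof. by apply: (can_inj (dPhi_invK t)); rewrite path_linear !dPhi_invKV. Qed.

Lemma Ck_on_path k X : Ck_on k setT (fun t => Phi t X).
Proof.
have [_ sP] := aP.
have C : Ck_on k setT (fun t : R => (t, X) : R * h).
  have [l lE] : exists l : {linear R -> (R * h)%type}, l = (fun t => (t, 0)) :> (_ -> _).
    apply: linear_packed => a u v; apply/pair_equal_spec; split=> //=.
    by rewrite scaler0 addr0.
  have -> : (fun t : R => (t, X) : R * h) = fun t => (0, X) + l t.
    apply/funext => t; rewrite lE; apply/pair_equal_spec.
    by rewrite /= add0r addr0.
  apply: smooth_on_affine; last exact: openT.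
  exact/finite_dim_continuous/finite_dim_scalar.
apply: (@Ck_on_comp _ _ _ _ _ setT setT (fun t => (t, X) : R * h)
  (fun x => Phi x.1 x.2)) => //.
- exact: finite_dim_space.
- exact: openT.
- exact: openT.
Qed.

Lemma path_differentiable t X : differentiable (fun s => Phi s X) t.
Proof. by have [d _] := Ck_on_path 1 X; exact: d. Qed.

Definition velocity (t : R) (X : h) : h := derive1 (fun s => Phi s X) t.

Lemma velocityE t X : velocity t X = 'd (fun s => Phi s X) t 1.
Proof. by apply: derive1E'; exact: path_differentiable. Qed.

Lemma Ck_on_velocity k X : Ck_on k setT (fun t => velocity t X).
Proof.
have -> : (fun t => velocity t X) = fun t => 'd (fun s => Phi s X) t 1.
  by apply/funext => t; exact: velocityE.
by have [_ C] := Ck_on_path k.+1 X; exact: C.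
Qed.

(** The differential at the unit disappears, automorphisms being linear. *)
Lemma log_derivE t X : log_deriv Phi t X = dPhi_inv Phi t (velocity t X).
Proof.
have E : (fun s => dPhi Phi s X) = (fun s => Phi s X).
  by apply/funext => s; rewrite dPhiE.
by rewrite /log_deriv E.
Qed.

Lemma Ck_on_dPhi_inv k X : Ck_on k setT (fun t => dPhi_inv Phi t X).
Proof.
apply: (@Ck_on_inverse_family _ _ _ _ _ Phi) => //.
- exact: finite_dim_heis.
- exact: openT.
- by move=> t _; exact: path_linear.
- by move=> t _; exact: dPhi_invK.
- by move=> u; exact: Ck_on_path.
Qed.

Lemma Ck_on_log_deriv k X : Ck_on k setT (fun t => log_deriv Phi t X).
Proof.
have -> : (fun t => log_deriv Phi t X) = fun t => dPhi_inv Phi t (velocity t X).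
  by apply/funext => t; exact: log_derivE.
apply: (@Ck_on_family _ _ _ _ _ _ (dPhi_inv Phi) (fun t => velocity t X)).
- exact: finite_dim_heis.
- exact: openT.
- by move=> t _; exact: dPhi_inv_linear.
- by move=> u; exact: Ck_on_dPhi_inv.
- exact: Ck_on_velocity.
Qed.

(** The component along [H] of the fundamental field, namely the image of
    [Phi_t Y] under the differential at the unit of right translation by [g]. *)
Definition fund_vec (x : R * h) (Y : h) : h :=
  Phi x.1 Y - 2^-1 *: bracket (Phi x.1 Y) x.2.

Lemma fundE x Y : fund Phi x Y = (0, fund_vec x Y).
Proof.
have [l lE] : exists l : {linear R -> (R * h)%type},
    l = (fun r => r *: ((0, fund_vec x Y) : R * h)) :> (R -> _).
  by apply: linear_packed => a u v; rewrite scalerDl scalerA.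
have cl : continuous l by exact/finite_dim_continuous/finite_dim_scalar.
have E : (fun r : R => hact Phi (r *: Y) x) = fun r => x + l r.
  apply/funext => r; rewrite lE /hact -[r *: Y]addr0 path_linear.
  have [f fE] := linear_packed (path_linear x.1); rewrite -fE linear0 fE addr0.
  rewrite [in RHS](surjective_pairing x); apply/pair_equal_spec; split=> /=.
    by rewrite scaler0 addr0.
  rewrite hmulE bracketZr /fund_vec (bracketC (Phi _ _)).
  by rewrite scalerDr !scalerN !scalerA mulrC.
have dE : differentiable (fun r => x + l r) 0.
  by have [d _] := smooth_on_affine x cl (@openT R) 1%N; exact: d.
by rewrite /fund E (derive1E' dE) diff_affineE // lE scale1r.
Qed.

(** Adding half a bracket undoes subtracting it, as double brackets vanish. *)
Definition fund_inv (x : R * h) (k : h) : h :=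
  dPhi_inv Phi x.1 (k + 2^-1 *: bracket k x.2).

Lemma fund_invK x : cancel (fund_inv x) (fund_vec x).
Proof.
move=> k; rewrite /fund_vec /fund_inv dPhi_invKV bracketDl bracketZl.
by rewrite bracket_bracketl scaler0 addr0 addrK.
Qed.

Lemma fund_vecK x : cancel (fund_vec x) (fund_inv x).
Proof.
move=> Y; rewrite /fund_vec /fund_inv bracketDl bracketNl bracketZl.
by rewrite bracket_bracketl scaler0 oppr0 addr0 subrK dPhi_invK.
Qed.

Lemma fund_inv_linear x (a : R) U V :
  fund_inv x (a *: U + V) = a *: fund_inv x U + fund_inv x V.
Proof.
rewrite /fund_inv -dPhi_inv_linear; congr (dPhi_inv _ _ _).
by rewrite bracket_linearl !scalerDr !scalerA (mulrC a) addrACA.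
Qed.

Lemma Ck_on_fund_inv k Y : Ck_on k setT (fun x => fund_inv x Y).
Proof.
have o : open [set: R * h] by exact: openT.
have [f1 f1E] : exists l : {linear (R * h)%type -> R}, l = fst :> (R * h -> R).
  exact: linear_packed.
have [f2 f2E] : exists l : {linear (R * h)%type -> h}, l = snd :> (R * h -> h).
  exact: linear_packed.
have C1 m : Ck_on m setT (fst : R * h -> R).
  by rewrite -f1E; apply: Ck_on_linear; exact/finite_dim_continuous/finite_dim_space.
have C2 m : Ck_on m setT (snd : R * h -> h).
  by rewrite -f2E; apply: Ck_on_linear; exact/finite_dim_continuous/finite_dim_space.
apply: (@Ck_on_family _ _ _ _ _ _ (fun x => dPhi_inv Phi x.1)
  (fun x => Y + 2^-1 *: bracket Y x.2)) => //.
- exact: finite_dim_heis.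
- by move=> x _; exact: dPhi_inv_linear.
- move=> u; apply: (@Ck_on_comp _ _ _ _ _ setT setT fst (fun t => dPhi_inv Phi t u)) => //.
  + exact: finite_dim_scalar.
  + exact: openT.
  + exact: Ck_on_dPhi_inv.
- apply: Ck_onD => //; first exact: Ck_on_cst.
  apply: Ck_onZ => //; first exact: Ck_on_cst.
  by apply: Ck_on_bracket => //; exact: Ck_on_cst.
Qed.

End AutomorphismPaths.

(** The values that define the associated metric are those of a symmetric form
    on two isotropic vectors of product 1 and on vectors orthogonal to both. *)
Lemma null_pair_expand (R : realType) (T : lmodType R) (b : T -> T -> R)
    (w z P Q : T) (a c a' c' : R) :
  (forall a u v w, b (a *: u + v) w = a * b u w + b v w) ->
  (forall u v, b u v = b v u) ->
  b w w = 0 -> b w z = 1 -> b w P = 0 -> b w Q = 0 ->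
  b z z = 0 -> b z P = 0 -> b z Q = 0 ->
  b (a *: w + (c *: z + P)) (a' *: w + (c' *: z + Q)) = a * c' + a' * c + b P Q.
Proof.
move=> bl bs ww wz wP wQ zz zP zQ.
have br d u v v' : b u (d *: v + v') = d * b u v + b u v' by rewrite bs bl !(bs u).
rewrite bl br (br c' w) ww wz wQ bl br (br c' z) (bs z w) wz zz zQ.
rewrite br (br c' P) (bs P w) wP (bs P z) zP.
by ring.
Qed.

Section AssociatedMetric.
Context {R : realType} {n : nat}.
Local Notation h := (heis R n).
Context (Phi : R -> h -> h) (p : set h) (Z0 : h).
Hypothesis aP : aut_path Phi.
Hypothesis Z0c : hcenter Z0.
Hypothesis Z0n : Z0 != 0.
Hypothesis sp : splitting p Z0.
Hypothesis mP : metric_defining Phi p Z0.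

Local Notation nuinv t := (split_ext_inv p Z0 (log_deriv Phi t)).
Local Notation zc := (zcoord p Z0).
Local Notation pp := (pproj p Z0).

(** The associated metric read in the frame [W], [f_x(Z0)], [f_x(p)]: each vector [u]
    is [u.1 *: W + f_x U] with [U = fund_inv x u.2]. *)
Definition canonical_metric (x u v : R * h) : R :=
  let U := fund_inv Phi x u.2 in let V := fund_inv Phi x v.2 in
  u.1 * zc V + v.1 * zc U + omega0 Z0 (nuinv x.1 (pp U)) (pp V).

Lemma canonical_metric_associated : associated_metric Phi p Z0 canonical_metric.
Proof.
have mt t := mP t.
have fi0 x : fund_inv Phi x 0 = 0.
  by have [l lE] := linear_packed (fund_inv_linear aP x); rewrite -lE linear0.
have ni0 t : nuinv t 0 = 0.
  have [l lE] := linear_packed (split_ext_inv_linear Z0n sp (mt t)).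
  by rewrite -lE linear0.
have pp0 : pp 0 = 0 by apply: pproj_id => //; exact: (split_p0 sp).
have z0 : zc 0 = 0 by exact: zcoord0.
have zp P : p P -> zc P = 0 by exact: zcoord_p.
have zZ : zc Z0 = 1 by exact: zcoord_Z0.
have pZ : pp Z0 = 0 by exact: pproj_Z0.
have pPid P : p P -> pp P = P by exact: pproj_id.
move=> x f; rewrite {}/f; split.
- move=> a u v w; rewrite /canonical_metric /= (fund_inv_linear aP).
  rewrite zcoord_linear // pproj_linear // (split_ext_inv_linear Z0n sp (mt _)).
  by rewrite omega0_linearl /GRing.scale /=; ring.
- move=> u v; rewrite /canonical_metric /=.
  rewrite (split_ext_inv_sym Z0c Z0n sp (mt _)); try exact: pproj_p.
  by ring.
- rewrite /canonical_metric /Wfield !(fundE aP) /= !(fund_vecK aP) fi0.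
  split.
  + by rewrite pp0 ni0 omega00l z0; ring.
  + by rewrite pp0 ni0 omega00l z0 zZ; ring.
  + move=> X pX; rewrite (fundE aP) /= (fund_vecK aP) pp0 ni0 omega00l z0 zp //.
    by ring.
- rewrite /canonical_metric !(fundE aP) /= !(fund_vecK aP); split.
    by rewrite pZ ni0 omega00l; ring.
  by move=> X pX; rewrite (fundE aP) /= (fund_vecK aP) pZ ni0 omega00l; ring.
- move=> X Y pX pY; rewrite /canonical_metric !(fundE aP) /= !(fund_vecK aP).
  rewrite !zp // !pPid // /nu_inv (pinv_split_ext Z0n sp (mt _)) //.
  by ring.
Qed.

Lemma frame_decomposition x u : u = u.1 *: Wfield +
  (zc (fund_inv Phi x u.2) *: fund Phi x Z0 + fund Phi x (pp (fund_inv Phi x u.2))).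
Proof.
rewrite !(fundE aP); case: u => a k; apply/pair_equal_spec; split=> /=.
  by rewrite scaler0 !addr0 /GRing.scale /= mulr1.
rewrite scaler0 add0r -[LHS](fund_invK aP x).
set U := fund_inv Phi x k; rewrite -{1}(pprojK p Z0 U).
have fl (c : R) V W : fund_vec Phi x (c *: V + W) = c *: fund_vec Phi x V + fund_vec Phi x W.
  apply: (can_inj (fund_invK aP x)); rewrite (fund_inv_linear aP).
  by rewrite !(fund_vecK aP).
by rewrite addrC fl.
Qed.

Lemma associated_metric_unique g :
  associated_metric Phi p Z0 g -> g = canonical_metric.
Proof.
move=> gA; apply/funext => x; apply/funext => u; apply/funext => v.
suff E g' : associated_metric Phi p Z0 g' -> g' x u v =
    u.1 * zc (fund_inv Phi x v.2) + v.1 * zc (fund_inv Phi x u.2) +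
    omega0 Z0 (nu_inv Phi p x.1 (pp (fund_inv Phi x u.2))) (pp (fund_inv Phi x v.2)).
  by rewrite (E _ gA) (E _ canonical_metric_associated).
move=> /(_ x)[bl bs [WW WZ Wp] [ZZ Zp] pq].
have pU := pproj_p sp (fund_inv Phi x u.2).
have pV := pproj_p sp (fund_inv Phi x v.2).
rewrite [in LHS](frame_decomposition x u) [in LHS](frame_decomposition x v).
rewrite (null_pair_expand _ _ _ _ bl bs WW WZ (Wp _ pU) (Wp _ pV) ZZ (Zp _ pU) (Zp _ pV)).
by rewrite pq.
Qed.

(** The vector [W - f_x(Z0)] is timelike.  A vector [a W + c f_x(Z0) + f_x P] orthogonal
    to it has [a = c], so that its square is [2 a ^ 2] plus the positive definite term
    in [P]. *)
Lemma canonical_metric_lorentz : lorentz_metric_on setT canonical_metric.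
Proof.
have mt t := mP t.
split=> [x _|u v k].
  have [bl bs _ _ _] := canonical_metric_associated x.
  split=> //.
  have pE V : pp (- V) = - pp V.
    by have [l lE] := linear_packed (pproj_linear Z0n sp); rewrite -lE linearN.
  have zE V : zc (- V) = - zc V.
    have := zcoord_linear Z0n sp (-1) V 0.
    by rewrite scaleN1r (zcoord0 Z0n sp) !addr0 mulN1r.
  have ni0 : nuinv x.1 0 = 0.
    have [l lE] := linear_packed (split_ext_inv_linear Z0n sp (mt x.1)).
    by rewrite -lE linear0.
  have E v : canonical_metric x (1, fund_vec Phi x (- Z0)) v =
      zc (fund_inv Phi x v.2) - v.1.
    rewrite /canonical_metric /= (fund_vecK aP) pE (pproj_Z0 Z0n sp) oppr0 ni0.
    by rewrite omega00l zE (zcoord_Z0 Z0n sp); ring.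
  (* The timelike vector [W - f_x(Z0)]. *)
  exists (1, fund_vec Phi x (- Z0)).
    by rewrite E /= (fund_vecK aP) zE (zcoord_Z0 Z0n sp); lra.
  move=> v; rewrite E => /eqP; rewrite subr_eq0 => /eqP zV v0.
  rewrite /canonical_metric zV.
  have [P0|P0] := eqVneq (pp (fund_inv Phi x v.2)) 0.
    rewrite P0 ni0 omega00l addr0.
    have v1 : v.1 != 0.
      apply: contraNneq v0 => v1; rewrite [v]surjective_pairing v1.
      apply/eqP; congr (_, _); rewrite -[LHS](fund_invK aP x).
      rewrite -(pprojK p Z0 (fund_inv Phi x v.2)) P0 zV v1 scale0r addr0.
      rewrite /fund_vec; have [l lE] := linear_packed (path_linear aP x.1).
      by rewrite -lE linear0 bracket0l scaler0 subr0.
    by rewrite -mulr2n pmulrn_rgt0 // lt0r mulf_neq0 //= -expr2 sqr_ge0.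
  apply: ltr_wpDl.
    by rewrite -mulr2n mulrn_wge0 // -expr2 sqr_ge0.
  by apply: (split_ext_inv_pos Z0n sp (mt _)) => //; exact: pproj_p.
have o : open [set: R * h] by exact: openT.
have CU w := Ck_on_fund_inv aP k w.
have lin_comp (f : h -> R) : (forall (a : R) U V, f (a *: U + V) = a * f U + f V) ->
    forall w, Ck_on k setT (fun x : R * h => f (fund_inv Phi x w)).
  move=> lf w; have [l <-] := linear_packed lf.
  apply: Ck_on_linear_comp => //; exact/finite_dim_continuous/finite_dim_heis.
have Czc w : Ck_on k setT (fun x : R * h => zc (fund_inv Phi x w)).
  by apply: lin_comp; exact: zcoord_linear.
have Cpp w : Ck_on k setT (fun x : R * h => pp (fund_inv Phi x w)).
  have [l <-] := linear_packed (pproj_linear Z0n sp).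
  apply: Ck_on_linear_comp => //; exact/finite_dim_continuous/finite_dim_heis.
rewrite /canonical_metric /=.
apply: Ck_onD => //; last first.
  apply: (@Ck_on_bilinear _ _ _ _ _ _ _ (omega0 Z0)) => //.
  - exact: finite_dim_heis.
  - exact: finite_dim_heis.
  - by move=> w a u' v'; exact: omega0_linearr.
  - by move=> w a u' v'; exact: omega0_linearl.
  apply: (@Ck_on_family _ _ _ _ _ _ (fun x : R * h => nuinv x.1)
    (fun x => pp (fund_inv Phi x u.2))) => //.
  - exact: finite_dim_heis.
  - by move=> x _; exact: (split_ext_inv_linear Z0n sp (mt _)).
  move=> w; have [f1 f1E] : exists l : {linear (R * h)%type -> R}, l = fst :> (R * h -> R).
    exact: linear_packed.
  apply: (@Ck_on_comp _ _ _ _ _ setT setT fst (fun t => nuinv t w)) => //.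
  - exact: finite_dim_scalar.
  - exact: openT.
  - by rewrite -f1E; apply: Ck_on_linear; exact/finite_dim_continuous/finite_dim_space.
  apply: (@Ck_on_inverse_family _ _ _ _ _ (fun t => split_ext p Z0 (log_deriv Phi t))
    (fun t => nuinv t)).
  - exact: finite_dim_heis.
  - exact: openT.
  - by move=> t _; exact: (split_ext_linear Z0n sp (mt t)).
  - by move=> t _; exact: (split_extK Z0n sp (mt t)).
  move=> V; apply: Ck_onD; [exact: openT|exact: Ck_on_log_deriv|exact: Ck_on_cst].
by apply: Ck_onD => //; apply: Ck_onM => //; exact: Ck_on_cst.
Qed.

End AssociatedMetric.

(** * The action of Gamma *)

Section GammaAction.
Context {R : realType} {n : nat}.
Local Notation h := (heis R n).
Context (Phi : R -> h -> h) (L : set h).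
Hypothesis aP : aut_path Phi.
Hypothesis eP : Z_equivariant Phi.
Hypothesis Lg : subgroup L.
Hypothesis pL : preserved Phi L.

Lemma equiv_path0 g : Phi 0 g = g.
Proof.
by apply: (lie_aut_inj (path_aut aP 0)); rewrite -(eP 0 0) addr0.
Qed.

Lemma equiv_pathN (q : int) g : Phi q%:~R (Phi (- q)%:~R g) = g.
Proof. by rewrite -eP -intrD subrr equiv_path0. Qed.

Lemma path_preserved (q : int) l : L l -> L (Phi q%:~R l).
Proof. by move=> Ll; rewrite -(pL q); exists l. Qed.

Lemma path_hmul t g k : Phi t (hmul g k) = hmul (Phi t g) (Phi t k).
Proof. by have [fM _] := path_aut aP t; exact: fM. Qed.

Lemma path_opp t g : Phi t (- g) = - Phi t g.
Proof. by have [l lE] := linear_packed (path_linear aP t); rewrite -lE linearN. Qed.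

Lemma gamma_act1 x : gamma_act Phi x (0, 0) = x.
Proof.
by rewrite /gamma_act /= addr0 equiv_path0 hmulg0 -surjective_pairing.
Qed.

Lemma gamma_mul_closed c d : gamma L c -> gamma L d -> gamma L (gamma_mul Phi c d).
Proof.
case: Lg => _ LM _; rewrite /gamma /= => Lc Ld; apply: LM => //.
exact: path_preserved.
Qed.

Lemma gamma_actM x c d :
  gamma_act Phi (gamma_act Phi x c) d = gamma_act Phi x (gamma_mul Phi c d).
Proof.
rewrite /gamma_act /gamma_mul /=; apply/pair_equal_spec; split=> /=.
  by rewrite intrD addrA.
by rewrite path_hmul hmulA -eP -intrD addrC.
Qed.

Lemma gamma_action : gamma_right_action Phi L.
Proof.
split=> [|x c d Gc Gd]; first exact: gamma_act1.
by split; [exact: gamma_mul_closed|exact: gamma_actM].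
Qed.

Definition gamma_inv (c : int * h) : int * h := (- c.1, - Phi (- c.1)%:~R c.2).

Lemma gamma_inv_closed c : gamma L c -> gamma L (gamma_inv c).
Proof. by case: Lg => _ _ LN Gc; apply: LN; exact: path_preserved. Qed.

Lemma gamma_actK c : cancel (gamma_act Phi ^~ c) (gamma_act Phi ^~ (gamma_inv c)).
Proof.
move=> x; rewrite gamma_actM -[RHS]gamma_act1; congr gamma_act.
by rewrite /gamma_mul /= subrr hmulgN.
Qed.

Lemma gamma_actKV c : cancel (gamma_act Phi ^~ (gamma_inv c)) (gamma_act Phi ^~ c).
Proof.
move=> x; rewrite gamma_actM -[RHS]gamma_act1; congr gamma_act.
by rewrite /gamma_mul /= addNr path_opp equiv_pathN hmulNg.
Qed.

Lemma gamma_orbitP x y : gamma_orbit Phi L x = gamma_orbit Phi L y <->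
  exists2 c, gamma L c & gamma_act Phi x c = y.
Proof.
have [L0 _ _] := Lg.
split=> [xy|[c Gc <-]].
  have : gamma_orbit Phi L y y by exists (0, 0); [exact: L0|exact: gamma_act1].
  by rewrite -xy.
apply/seteqP; split=> _ [d Gd <-].
  exists (gamma_mul Phi (gamma_inv c) d).
    by apply: gamma_mul_closed => //; exact: gamma_inv_closed.
  by rewrite -gamma_actM gamma_actK.
by exists (gamma_mul Phi c d); [exact: gamma_mul_closed|rewrite -gamma_actM].
Qed.

(** Right translation is affine in the exponential coordinates of a two-step
    group, and [Phi_q] is linear. *)
Lemma gamma_act_affine c : exists l : {linear (R * h)%type -> (R * h)%type},
  l = (fun u => (u.1, Phi c.1%:~R u.2 - 2^-1 *: bracket (Phi c.1%:~R u.2) c.2))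
    :> (R * h -> R * h) /\
  (fun x => gamma_act Phi x c) = fun x => ((c.1%:~R, c.2) : R * h) + l x.
Proof.
have [l lE] : exists l : {linear (R * h)%type -> (R * h)%type},
  l = (fun u => (u.1, Phi c.1%:~R u.2 - 2^-1 *: bracket (Phi c.1%:~R u.2) c.2))
    :> (R * h -> R * h).
  apply: linear_packed => a u v; apply/pair_equal_spec; split=> //=.
  rewrite (path_linear aP) bracket_linearl !scalerDr scalerN opprD !scalerA.
  by rewrite (mulrC a) addrACA.
exists l; split=> //; apply/funext => x; rewrite lE /gamma_act.
apply/pair_equal_spec; split=> /=; first by rewrite addrC.
by rewrite /hmul addrA (addrC c.2).
Qed.

Lemma gamma_act_diff c x u : 'd (fun y => gamma_act Phi y c) x u =
  (u.1, Phi c.1%:~R u.2 - 2^-1 *: bracket (Phi c.1%:~R u.2) c.2).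
Proof.
have [l [lE ->]] := gamma_act_affine c.
have cl : continuous l by exact/finite_dim_continuous/finite_dim_space.
by rewrite (diff_affineE _ cl) lE.
Qed.

Lemma gamma_act_smooth c : smooth_on setT (fun x => gamma_act Phi x c).
Proof.
have [l [_ ->]] := gamma_act_affine c.
apply: smooth_on_affine; last exact: openT.
exact/finite_dim_continuous/finite_dim_space.
Qed.

Lemma gamma_act_diffeo c : diffeo_on setT setT (fun x => gamma_act Phi x c).
Proof.
split; [exact: openT|exact: openT|exact: gamma_act_smooth|].
exists (fun x => gamma_act Phi x (gamma_inv c)); split.
- exact: gamma_act_smooth.
- by move=> x _; split=> //; exact: gamma_actK.
- by move=> x _; split=> //; exact: gamma_actKV.
Qed.

(** Differentiate [Phi_{q + s} X = Phi_q (Phi_s X)] in [s], for [Phi_q] linear. *)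
Lemma velocity_equivariant (q : int) t X :
  velocity Phi (q%:~R + t) X = Phi q%:~R (velocity Phi t X).
Proof.
rewrite !(velocityE aP).
have [l lE] := linear_packed (path_linear aP q%:~R).
have cl : continuous l by exact/finite_dim_continuous/finite_dim_heis.
have E : (fun s => Phi (q%:~R + s) X) = (fun s => l (Phi s X)).
  by apply/funext => s; rewrite eP lE.
have dl y : differentiable l y by exact: linear_differentiable.
have e1 := @diff_translateE _ _ _ (fun s : R => Phi s X) q%:~R t 1
  (path_differentiable aP _ X).
have e2 := @diff_compE _ _ _ _ (fun s : R => Phi s X) l t 1
  (path_differentiable aP t X) (dl _).
have e3 := @diff_linE _ _ _ l (Phi t X) ('d (fun s : R => Phi s X) t 1) cl.
exact: etrans (esym e1) (etrans (congr1 (fun f : R -> h => 'd f t 1) E)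
  (etrans e2 (etrans e3 (congr1 (fun f : h -> h => f _) lE)))).
Qed.

Lemma log_deriv_equivariant (q : int) t :
  log_deriv Phi (t + q%:~R) = log_deriv Phi t.
Proof.
apply/funext => X; rewrite !(log_derivE aP) addrC velocity_equivariant.
apply: (can_inj (dPhi_invK aP (q%:~R + t))).
by rewrite (dPhi_invKV aP) eP (dPhi_invKV aP).
Qed.

(** Infinitesimal form of
    [Phi_{t+q} (h) (Phi_q (g) l) = Phi_q (Phi_t (h) g) l]: the actions of [Gamma] and
    of [H] commute. *)
Lemma gamma_act_fund c x Y : 'd (fun y => gamma_act Phi y c) x (fund Phi x Y) =
  fund Phi (gamma_act Phi x c) Y.
Proof.
rewrite gamma_act_diff !(fundE aP); apply/pair_equal_spec; split=> //=.
rewrite /fund_vec /= (addrC x.1) eP.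
have [l lE] := linear_packed (path_linear aP c.1%:~R).
have fB U V : Phi c.1%:~R (U - 2^-1 *: V) = Phi c.1%:~R U - 2^-1 *: Phi c.1%:~R V.
  by rewrite -lE linearB linearZ.
rewrite fB (lie_aut_bracket (path_aut aP _)).
rewrite /hmul !(bracketDr, bracketDl, bracketNr, bracketNl, bracketZr, bracketZl).
rewrite bracket_bracketl bracket_bracketr !scaler0 !subr0.
by rewrite scalerDr opprD addrA.
Qed.

Hypothesis Ld : discrete_subset L.

(** Near [D] the set [L] has at most one point, since two points [g], [k] close to
    each other have [g^-1 k] close to the unit; a point other than [D] is avoided
    by shrinking.  This covers both discreteness and closedness of [L]. *)
Lemma discrete_subgroup_isolated (D : h) : \forall g \near D, L g -> g = D.
Proof.
have [L0 LM LN] := Lg; have [U U0 UL] := Ld L0.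
have : \forall z \near (D, D), U (hmul (- z.1) z.2).
  have c : {for (D, D), continuous (fun z : h * h => hmul (- z.1) z.2)}.
    apply: continuous_hmul; last exact: cvg_snd.
    by apply: continuousN; exact: cvg_fst.
  by apply: c; rewrite /= hmulNg.
move=> [[A B] [/= AD BD] AB].
have one g k : A g -> B g -> A k -> B k -> L g -> L k -> g = k.
  move=> Ag Bg Ak Bk Lg' Lk; have UgL : (U `&` L) (hmul (- g) k).
    split; first by apply: (AB (g, k)).
    by apply: LM => //; exact: LN.
  move: UgL; rewrite UL => /= gk.
  by rewrite -(hmulKNg g k) gk hmulg0.
have [[l [[Al Bl] Ll]]|none] := pselect (exists l, (A l /\ B l) /\ L l); last first.
  apply: filterS2 AD BD => g Ag Bg Lg'; exfalso; apply: none; by exists g.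
have [lD|/eqP lD] := eqVneq l D.
  by apply: filterS2 AD BD => g Ag Bg Lg'; rewrite -lD; exact: one.
have : \forall g \near D, g <> l.
  have : open (~` [set l]).
    apply: closed_openC; apply: accessible_closed_set1.
    exact/hausdorff_accessible/norm_hausdorff.
  by move=> o; apply: open_nbhs_nbhs; split=> // Dl; apply: lD.
by apply: filterS3 AD BD => g Ag Bg gl Lg'; case: gl; exact: one.
Qed.

Lemma int_isolated (d : R) : \forall e \near d, forall q : int, e = q%:~R -> d = q%:~R.
Proof.
have [[q dq]|none] := pselect (exists q : int, d = q%:~R).
  have : d \in `]d - 1, d + 1[ by rewrite in_itv /=; apply/andP; split; lra.
  move=> /near_in_itvoo; apply: filterS => e; rewrite in_itv /= => /andP[e1 e2] r er.
  rewrite dq; congr (_ %:~R); apply/eqP; rewrite eq_le.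
  move: e1 e2; rewrite er dq -[1]/(1%:~R) -intrD -intrB !ltr_int => e1 e2.
  by apply/andP; split; lia.
have d1 : d \in `](Num.floor d)%:~R, (Num.floor d + 1)%:~R[.
  rewrite in_itv /= floorD1_gt andbT lt_neqAle floor_le andbT.
  by apply/eqP => dE; apply: none; exists (Num.floor d).
move: d1 => /near_in_itvoo; apply: filterS => e.
rewrite in_itv /= => /andP[e1 e2] q eq; exfalso.
by move: e1 e2; rewrite eq !ltr_int; lia.
Qed.

(** The element [(q, l)] is determined by the two points: [q] is the difference of
    the first coordinates and [l = Phi_q(g)^-1 g'].  Both depend continuously on
    the points and lie in closed discrete sets, hence are locally constant. *)
Lemma gamma_act_proper x y : \forall z \near (x, y),
  forall c, gamma L c -> gamma_act Phi z.1 c = z.2 -> gamma_act Phi x c = y.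
Proof.
have : \forall z \near (x, y), forall q : int, z.2.1 - z.1.1 = q%:~R -> y.1 - x.1 = q%:~R.
  have c : {for (x, y), continuous (fun z : (R * h) * (R * h) => z.2.1 - z.1.1)}.
    apply: continuousB.
      by apply: (@continuous_comp _ _ _ snd fst); [exact: cvg_snd|exact: cvg_fst].
    by apply: (@continuous_comp _ _ _ fst fst); [exact: cvg_fst|exact: cvg_fst].
  exact: c (int_isolated (y.1 - x.1)).
have [[q xq]|none] := pselect (exists q : int, y.1 - x.1 = q%:~R); last first.
  apply: filterS => z H [q l] Gc zc; exfalso; apply: none; exists q; apply: H.
  by rewrite -zc /gamma_act /= addrAC subrr add0r.
have cq : continuous (Phi q%:~R).
  have [l <-] := linear_packed (path_linear aP q%:~R).
  exact/finite_dim_continuous/finite_dim_heis.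
(* The only [l] for which [(q, l)] can map [z.1] to [z.2]. *)
pose F (z : (R * h) * (R * h)) : h := hmul (- Phi q%:~R z.1.2) z.2.2.
have cF : {for (x, y), continuous F}.
  apply: continuous_hmul.
    apply: continuousN; apply: (@continuous_comp _ _ _ (fun z => z.1.2) (Phi q%:~R)).
      by apply: (@continuous_comp _ _ _ fst snd); [exact: cvg_fst|exact: cvg_snd].
    exact: cq.
  by apply: (@continuous_comp _ _ _ snd snd); [exact: cvg_snd|exact: cvg_snd].
have : \forall z \near (x, y), L (F z) -> F z = F (x, y).
  exact: cF (discrete_subgroup_isolated (F (x, y))).
apply: filterS2 => z H1 H2 [r l] Ll zc.
have rq : r = q.
  apply: (@intr_inj R); rewrite -xq; apply/esym/H2.
  by rewrite -zc /gamma_act /= addrAC subrr add0r.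
rewrite {}rq in zc *.
have Fz : F z = l by rewrite /F -zc /gamma_act /= hmulKg.
have lE : l = F (x, y) by rewrite -Fz; apply: H1; rewrite Fz.
rewrite [RHS]surjective_pairing /gamma_act lE; apply/pair_equal_spec; split=> /=.
  by move/eqP: xq; rewrite subr_eq addrC => /eqP/esym.
exact: hmulKNg.
Qed.

Lemma gamma_act_free c x : gamma_act Phi x c = x -> forall y, gamma_act Phi y c = y.
Proof.
case: c => q l; rewrite /gamma_act /= => E y; move: E.
rewrite [X in _ = X]surjective_pairing => /pair_equal_spec[/= E1 E2].
have q0 : q = 0.
  apply: (@intr_inj R); apply: (@addrI _ x.1); by rewrite addr0.
move: E2; rewrite q0 equiv_path0 => E2.
have -> : l = 0 by rewrite -(hmulKg x.2 l) E2 hmulNg.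
exact: gamma_act1.
Qed.

(** The integer part of [t] is absorbed by [Z], and the rest by [L]: the quotient
    is the image of [[0, 1] x K]. *)
Lemma gamma_quotient_compact (K : set h) : compact K ->
  (forall g, exists k l, [/\ K k, L l & hmul g l = k]) ->
  compact [set: orbit_space (gamma_orbit Phi L)].
Proof.
move=> cK KL.
have -> : [set: orbit_space (gamma_orbit Phi L)] =
    orbit_proj (gamma_orbit Phi L) @` ([set` `[0%R : R, 1]] `*` K).
  apply/seteqP; split=> // r _; have [x <-] := orbit_proj_surj r.
  pose q := - Num.floor x.1.
  have [k [l [Kk Ll kE]]] := KL (Phi q%:~R x.2).
  exists (gamma_act Phi x (q, l)).
    split=> /=; last by rewrite kE.
    rewrite in_itv /= mulrNz subr_ge0 floor_le /=.
    by rewrite lerBlDl -[1]/(1%:~R) -intrD ltW // floorD1_gt.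
  by apply/esym/orbit_proj_eq/gamma_orbitP; exists (q, l).
apply: continuous_compact.
  by apply: continuous_subspaceT; exact: orbit_proj_continuous.
have cI : compact [set` `[0%R : R, 1]] by exact: segment_compact.
exact: (compact_setX cI cK).
Qed.

Context (p : set h) (Z0 : h).
Hypothesis Z0c : hcenter Z0.
Hypothesis Z0n : Z0 != 0.
Hypothesis sp : splitting p Z0.
Hypothesis mP : metric_defining Phi p Z0.

(** The pulled back metric satisfies the relations defining the associated
    metric, because the action maps the frame to the frame and [nu] is periodic. *)
Lemma gamma_act_isometry g c : associated_metric Phi p Z0 g ->
  is_isometry g (fun x => gamma_act Phi x c).
Proof.
move=> gA; split; first exact: gamma_act_diffeo.
pose g' x u v := g (gamma_act Phi x c) ('d (fun x => gamma_act Phi x c) x u)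
  ('d (fun x => gamma_act Phi x c) x v).
suff g'A : associated_metric Phi p Z0 g'.
  move=> x u v; rewrite -[LHS]/(g' x u v).
  by rewrite (associated_metric_unique aP Z0c Z0n sp mP g'A)
    (associated_metric_unique aP Z0c Z0n sp mP gA).
have dW x : 'd (fun x => gamma_act Phi x c) x Wfield = Wfield.
  rewrite gamma_act_diff /Wfield /=; apply/pair_equal_spec; split=> //.
  have [l lE] := linear_packed (path_linear aP c.1%:~R).
  by rewrite -lE linear0 bracket0l scaler0 subr0.
move=> x f; rewrite {}/f; have [bl bs [WW WZ Wp] [ZZ Zp] pq] := gA (gamma_act Phi x c).
have dF Y := gamma_act_fund c x Y.
rewrite /g'; split.
- by move=> a u v w; rewrite linearP bl.
- by move=> u v; exact: bs.
- split=> [||X pX].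
  + by rewrite dW; exact: WW.
  + by rewrite dW dF; exact: WZ.
  + by rewrite dW dF; exact: Wp.
- split=> [|X pX].
  + by rewrite dF; exact: ZZ.
  + exact: etrans (f_equal2 (g (gamma_act Phi x c)) (dF Z0) (dF X)) (Zp X pX).
- move=> X Y pX pY.
  apply: etrans (f_equal2 (g (gamma_act Phi x c)) (dF X) (dF Y)) _.
  by rewrite (pq X Y pX pY) /nu_inv /= log_deriv_equivariant.
Qed.

End GammaAction.

Unset Implicit Arguments.

Theorem proposition3p6 (R : realType) (n : nat) (n_gt0 : (0 < n)%N)
    (Phi : R -> heis R n -> heis R n) (p : set (heis R n)) (Z0 : heis R n)
    (L : set (heis R n)) :
  aut_path Phi ->
  lattice_compatible Phi ->
  hcenter Z0 -> Z0 != 0 -> splitting p Z0 ->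
  metric_defining Phi p Z0 ->
  lattice L -> preserved Phi L ->
  let M := orbit_space (gamma_orbit Phi L) in
  let proj : R * heis R n -> M := orbit_proj (gamma_orbit Phi L) in
  gamma_right_action Phi L /\
  (exists! g, associated_metric Phi p Z0 g) /\
  (forall g : R * heis R n -> R * heis R n -> R * heis R n -> R,
    associated_metric Phi p Z0 g ->
    [/\ lorentz_metric_on setT g,
        forall c, gamma L c -> is_isometry g (fun x => gamma_act Phi x c),
        compact [set: M],
        exists A : set (chart (R * heis R n)%type M),
          smooth_manifold A /\ local_diffeo A proj &
        forall A : set (chart (R * heis R n)%type M),
          smooth_manifold A -> local_diffeo A proj ->
          exists h, lorentz_metric A h /\ is_pullback A proj h g]).
Proof.
move=> aP [eP _] Z0c Z0n sp mP lL pL M proj.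
have [Lg Ld _] := lL.
have fT : finite_dim (R * heis R n)%type by exact: finite_dim_space.
have orbP := gamma_orbitP aP eP Lg pL.
have smooth_act c : gamma L c -> smooth_on setT (fun x => gamma_act Phi x c).
  by move=> _; exact: gamma_act_smooth.
have proper_act := gamma_act_proper aP Lg Ld.
have free_act c x (_ : gamma L c) := @gamma_act_free _ _ _ aP eP c x.
split; first exact: gamma_action.
split.
  exists (canonical_metric Phi p Z0); split; first exact: canonical_metric_associated.
  by move=> g gA; apply/esym; exact: associated_metric_unique gA.
move=> g gA.
have lg : lorentz_metric_on setT g.
  by rewrite (associated_metric_unique aP Z0c Z0n sp mP gA); exact: canonical_metric_lorentz.
have ig c (_ : gamma L c) := gamma_act_isometry aP eP Z0c Z0n sp mP c gA.
split=> //.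
- have [K [cK KL]] := lattice_cocompact lL n_gt0.
  exact: gamma_quotient_compact cK KL.
- exists (@slice_atlas _ _ (gamma_orbit Phi L)); split.
    exact: (slice_atlas_manifold orbP smooth_act proper_act free_act fT).
  exact: (slice_atlas_local_diffeo orbP proper_act free_act).
- move=> A mA dA; exists (descended_metric g); split.
    apply: (descended_lorentz orbP smooth_act fT mA dA lg) => c Gc.
    by have [_ H] := ig c Gc; exact: H.
  apply: (descended_is_pullback orbP smooth_act fT mA dA) => c Gc.
  by have [_ H] := ig c Gc; exact: H.
Qed.
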